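(* Let $\mathcal{E}$ be an indecomposable, five-dimensional, nilpotent evolution algebra over an algebraically closed field $\mathbb{F}$ of characteristic not two, and fix $i\in\mathbb{F}$ with $i^2=-1$. Below, evolution algebras are given by the squares of the elements of a natural basis $\{e_1,\ldots,e_5\}$ (products $e_je_k$ with $j\neq k$ are $0$, and squares not listed are $0$). (i) If the type of $\mathcal{E}$ is $[1,4]$, then $\mathcal{E}$ is isomorphic to the algebra with $e_1^2=e_2^2=e_3^2=e_4^2=e_5$. (ii) If the type is $[1,3,1]$, then $\mathcal{E}$ is isomorphic to one and only one of the algebras: - $e_1^2=e_2$, $e_2^2=e_3^2=e_4^2=e_5$; - $e_1^2=e_2+i\,e_3$, $e_2^2=e_3^2=e_4^2=e_5$. (iii) If the type is $[1,1,3]$, then $\mathcal{E}$ is isomorphic to one of the algebras: - (1) $e_1^2=e_2^2=e_3^2=e_4$, $e_4^2=e_5$; - (2) $e_1^2=e_2^2=e_4$, $e_3^2=e_4+e_5$, $e_4^2=e_5$; - (3) $e_1^2=e_4+\alpha e_5$, $e_2^2=e_4$, $e_3^2=e_4+e_5$, $e_4^2=e_5$, with $\alpha\in\mathbb{F}\setminus\{0,1\}$. Algebras in different families among (1), (2), (3) are not isomorphic, and two algebras in family (3) with parameters $\alpha,\alpha'$ are isomorphic if and only if $\alpha'\in\{\alpha,\ \alpha^{-1},\ 1-\alpha,\ 1-\alpha^{-1},\ (1-\alpha)^{-1},\ (1-\alpha^{-1})^{-1}\}$. (iv) If the type is $[1,1,1,2]$, then $\mathcal{E}$ is isomorphic to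 one of the algebras: - (1) $e_1^2=e_2^2=e_3$, $e_3^2=e_4$, $e_4^2=e_5$; - (2) $e_1^2=e_3+e_5$, $e_2^2=e_3$, $e_3^2=e_4$, $e_4^2=e_5$; - (3) $e_1^2=e_3+e_4+\gamma e_5$, $e_2^2=e_3$, $e_3^2=e_4$, $e_4^2=e_5$, with $\gamma\in\mathbb{F}$; - (4) $e_1^2=e_3+e_4+\gamma e_5$, $e_2^2=e_3+\beta e_4$, $e_3^2=e_4$, $e_4^2=e_5$, with $\beta,\gamma\in\mathbb{F}$, $\beta\neq0$. Algebras in different families among (1)–(4) are not isomorphic. Algebras in family (3) with different values of the parameter $\gamma$ are not isomorphic. Finally, algebras in family (4) with parameters $(\beta,\gamma)$ and $(\beta',\gamma')$ are isomorphic if and only if $(\beta',\gamma')=(\beta,\gamma)$ or $(\beta',\gamma')=(\beta^{-1},-\beta^{-3}\gamma)$.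
   Context: An evolution algebra (finite-dimensional here) is an algebra $\mathcal{E}$ over $\mathbb{F}$ with a basis $\{e_1,\ldots,e_n\}$ (a natural basis) such that $e_je_k=0$ for $j\neq k$; it is automatically commutative, and need not be associative. An algebra is decomposable if it is the direct sum of two nonzero ideals, and indecomposable otherwise. For an algebra $\mathcal{A}$, $\mathrm{ann}(\mathcal{A})=\{x\in\mathcal{A}: x\mathcal{A}=\mathcal{A}x=0\}$, $\mathrm{ann}^0(\mathcal{A})=0$, and $\mathrm{ann}^j(\mathcal{A})$ is defined by $\mathrm{ann}^j(\mathcal{A})/\mathrm{ann}^{j-1}(\mathcal{A})=\mathrm{ann}(\mathcal{A}/\mathrm{ann}^{j-1}(\mathcal{A}))$. With $\mathcal{A}^1=\mathcal{A}$ and $\mathcal{A}^{k+1}=\sum_{j=1}^k\mathcal{A}^j\mathcal{A}^{k+1-j}$, $\mathcal{A}$ is nilpotent if $\mathcal{A}^m=0$ for some $m$, equivalently $\mathrm{ann}^r(\mathcal{A})=\mathcal{A}$ for some $r$. The type of a finite-dimensional nilpotent algebra $\mathcal{A}$ is the sequence $[n_1,\ldots,n_r]$, where $r$ is the least natural number with $\mathrm{ann}^r(\mathcal{A})=\mathcal{A}$ and $n_j=\dim\mathrm{ann}^j(\mathcal{A})-\dim\mathrm{ann}^{j-1}(\mathcal{A})$. *)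

(* Defs.v *)
From HB Require Import structures.
From mathcomp Require Import all_boot all_order all_algebra.

Set Implicit Arguments.
Unset Strict Implicit.
Unset Printing Implicit Defensive.

Import GRing.Theory.
Local Open Scope ring_scope.

(* Finite-dimensional algebras; the product need not be associative,          *)
(* commutative or unital, so that falgType does not apply.                    *)
Record nalgType (F : fieldType) := NAlg {
  nalg_sort :> vectType F;
  amul : {bilinear nalg_sort -> nalg_sort -> nalg_sort}
}.
Arguments amul {F n}.

Section NonAssociativeAlgebras.
Variable F : fieldType.
Implicit Types A B Q : nalgType F.

Definition natural_basis A (b : seq A) : Prop :=
  basis_of fullv b /\
  forall j k, (j < size b)%N -> (k < size b)%N -> j != k -> amul b`_j b`_k = 0.

Definition evolution_algebra A : Prop := exists b : seq A, natural_basis b.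

Definition ideal A (I : {vspace A}) : Prop :=
  forall x y : A, x \in I -> amul x y \in I /\ amul y x \in I.

Definition decomposable A : Prop :=
  exists I J : {vspace A},
    [/\ ideal I, ideal J, I != 0%VS, J != 0%VS
      & (I + J = fullv)%VS /\ (I :&: J = 0)%VS].

Definition indecomposable A : Prop := ~ decomposable A.

(* {x | x A <= U and A x <= U}: when U is an ideal, this is the preimage of   *)
(* ann(A / U) under A -> A / U; see memv_ann_mod and ann_mod_quotient.        *)
Definition ann_mod A (U : {vspace A}) : {vspace A} :=
  (\bigcap_(y <- vbasis {:A})
     ((linfun (amul y) @^-1: U) :&: (linfun (applyr amul y) @^-1: U)))%VS.

Definition ann A : {vspace A} := ann_mod 0%VS.

Definition ann_series A (j : nat) : {vspace A} := iter j (@ann_mod A) 0%VS.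

Definition prodvs A (U V : {vspace A}) : {vspace A} :=
  <<[seq amul u v | u <- vbasis U, v <- vbasis V]>>%VS.

(* The sequence [:: A^1; ...; A^k.+1].                                        *)
Fixpoint powers A (k : nat) : seq {vspace A} :=
  if k is k'.+1 then
    let s := powers A k' in
    rcons s (\sum_(j < k'.+1)
               prodvs (nth fullv s j) (nth fullv s (k' - j)))%VS
  else [:: fullv].

(* A^k for k >= 1 (A^0 is junk, equal to A); the recursion is apowS.          *)
Definition apow A (k : nat) : {vspace A} := nth fullv (powers A k.-1) k.-1.

Definition nilpotent A : Prop := exists2 m, (0 < m)%N & apow A m = 0%VS.

Definition has_type A (s : seq nat) : Prop :=
  [/\ ann_series A (size s) = fullv,
      forall r, (r < size s)%N -> ann_series A r <> fullv
    & forall j, (j < size s)%N ->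
        nth 0%N s j = (\dim (ann_series A j.+1) - \dim (ann_series A j))%N].

Definition isomorphic A B : Prop :=
  exists f : 'Hom(A, B),
    [/\ lker f = 0%VS, limg f = fullv
      & forall x y : A, f (amul x y) = amul (f x) (f y)].

Lemma memv_ann_mod A (U : {vspace A}) (x : A) :
  x \in ann_mod U <-> forall y : A, amul x y \in U /\ amul y x \in U.
Proof.
have big_cap (s : seq A) : (x \in (\bigcap_(y <- s)
     ((linfun (amul y) @^-1: U) :&: (linfun (applyr amul y) @^-1: U)))%VS) =
     all (fun y => (amul y x \in U) && (amul x y \in U)) s.
  elim: s => [|y s IH]; first by rewrite big_nil memvf.
  by rewrite big_cons memv_cap IH memv_cap -!memv_preim !lfunE.
rewrite big_cap; split=> [/allP h y | h]; last first.
  by apply/allP=> y _; have [-> ->] := h y.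
have hi i : (amul (vbasis {:A})`_i x \in U) /\ (amul x (vbasis {:A})`_i \in U).
  case: (ltnP i (size (vbasis {:A}))) => hi.
    by have /andP[] := h _ (mem_nth 0 hi).
  by rewrite nth_default // linear0l linear0r mem0v.
rewrite (coord_vbasis (memvf y)) linear_sumr linear_sumlz.
split; apply: memv_suml => i _; rewrite ?linearZr_LR ?linearZl_LR; apply: memvZ;
  by have [] := hi i.
Qed.

Lemma ann_mod_quotient A Q (p : 'Hom(A, Q)) :
    limg p = fullv -> (forall x y : A, p (amul x y) = amul (p x) (p y)) ->
  ann_mod (lker p) = (p @^-1: ann Q)%VS.
Proof.
move=> p_surj pM; apply/vspaceP=> x; rewrite -memv_preim.
apply/idP/idP=> /memv_ann_mod h; apply/memv_ann_mod=> y.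
  have : y \in limg p by rewrite p_surj memvf.
  case/memv_imgP=> z _ ->; rewrite -!pM !memv0 -!memv_ker.
  by have [-> ->] := h z.
by rewrite !memv_ker !pM -!memv0; have [-> ->] := h (p y).
Qed.

Lemma size_powers A k : size (powers A k) = k.+1.
Proof. by elim: k => //= k IH; rewrite size_rcons IH. Qed.

Lemma nth_powers A m k : (m <= k)%N -> nth fullv (powers A k) m = apow A m.+1.
Proof.
elim: k => [|k IH]; first by case: m.
rewrite leq_eqVlt => /predU1P[-> // | lt_mk] /=.
by rewrite nth_rcons size_powers lt_mk IH.
Qed.

Lemma apow1 A : apow A 1 = fullv. Proof. by []. Qed.

Lemma apowS A k : (0 < k)%N ->
  apow A k.+1 = (\sum_(1 <= j < k.+1) prodvs (apow A j) (apow A (k.+1 - j)))%VS.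
Proof.
case: k => // k _; rewrite {1}/apow [k.+2.-1]/= [powers A _]/=.
rewrite nth_rcons size_powers ltnn eqxx big_add1 big_mkord.
apply: eq_bigr => j _; rewrite !nth_powers ?leq_subr ?subSS ?subSn //.
  by rewrite -ltnS.
by rewrite -ltnS.
Qed.

End NonAssociativeAlgebras.

(* The evolution algebra on F^n whose natural basis is the standard basis,    *)
(* the square of its k-th element being sq k.                                 *)
Section ConcreteEvolutionAlgebras.
Variables (F : fieldType) (n : nat) (sq : 'I_n -> 'rV[F]_n).

Definition evol_mul (x y : 'rV[F]_n) : 'rV[F]_n :=
  \sum_(k < n) (x 0 k * y 0 k) *: sq k.

Lemma evol_mul_bilinear : bilinear_for
  (GRing.Scale.Law.clone _ _ *:%R _) (GRing.Scale.Law.clone _ _ *:%R _)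
  evol_mul.
Proof.
split=> [y a x x' | x a y y']; rewrite /evol_mul /= scaler_sumr -big_split /=;
  apply: eq_bigr => k _; rewrite scalerA -scalerDl !mxE.
  by rewrite mulrDl mulrA.
by rewrite mulrDr mulrCA.
Qed.

HB.instance Definition _ := bilinear_isBilinear.Build F
  'rV[F]_n 'rV[F]_n 'rV[F]_n
  (GRing.Scale.Law.clone _ _ *:%R _) (GRing.Scale.Law.clone _ _ *:%R _)
  evol_mul evol_mul_bilinear.

Definition evol_alg : nalgType F := @NAlg F 'rV[F]_n evol_mul.

End ConcreteEvolutionAlgebras.

(* The standard basis of F^5, numbered e_ 1, ..., e_ 5.                       *)
Definition std_basis5 (F : fieldType) (k : nat) : 'rV[F]_5 :=
  \row_(j < 5) (j.+1 == k)%:R.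
Notation "'e_' k" := (std_basis5 _ k) (at level 8, k at level 2, format "'e_' k").

Definition evol5 (F : fieldType) (s1 s2 s3 s4 s5 : 'rV[F]_5) : nalgType F :=
  evol_alg (fun k => [:: s1; s2; s3; s4; s5]`_k).

Lemma evol5_mul (F : fieldType) (s1 s2 s3 s4 s5 : 'rV[F]_5) (j k : nat) :
    (0 < j <= 5)%N -> (0 < k <= 5)%N ->
  amul (e_ j : evol5 s1 s2 s3 s4 s5) (e_ k) =
  if j == k then [:: s1; s2; s3; s4; s5]`_j.-1 else 0.
Proof.
case: j => // j; case: k => // k; rewrite /= !ltnS => hj hk.
rewrite /amul /= /evol_mul eqSS.
have [<- | neq_jk] := eqVneq j k.
  rewrite (bigD1 (Ordinal (hj : (j < 5)%N))) //= big1 ?addr0 => [|l neq_lj].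
    by rewrite !mxE eqxx mulr1 scale1r.
  rewrite !mxE eqSS [(l : nat) == j]negbTE ?mul0r ?scale0r //.
rewrite big1 // => l _; rewrite !mxE !eqSS.
have [-> | _] := eqVneq (l : nat) j; last by rewrite mul0r scale0r.
by rewrite (negbTE neq_jk) mulr0 scale0r.
Qed.

Lemma evol5_natural_basis (F : fieldType) (s1 s2 s3 s4 s5 : 'rV[F]_5) :
  @natural_basis F (evol5 s1 s2 s3 s4 s5) [:: e_ 1; e_ 2; e_ 3; e_ 4; e_ 5].
Proof.
split; last first.
  move=> j k hj hk neq_jk.
  have nthE i : (i < 5)%N ->
    [:: e_ 1; e_ 2; e_ 3; e_ 4; e_ 5]`_i = e_ i.+1 :> 'rV[F]_5.
    by case: i => [|[|[|[|[|i]]]]].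
  by rewrite !nthE // evol5_mul // eqSS (negbTE neq_jk).
rewrite basisEdim; apply/andP; split; last first.
  by rewrite dimvf /dim /= mul1n.
apply/subvP=> x _.
have -> : (x : 'rV[F]_5) = \sum_(k < 5) (x : 'rV[F]_5) 0 k *: e_ k.+1.
  apply/rowP=> j; rewrite summxE (bigD1 j) //= big1 => [|k neq_kj].
    by rewrite !mxE eqxx mulr1 addr0.
  by rewrite !mxE eqSS eq_sym [(k : nat) == j](negbTE neq_kj) mulr0.
apply: (@memv_suml _ (evol5 s1 s2 s3 s4 s5)) => k _; apply: memvZ.
by apply: memv_span; case: k => [[|[|[|[|[|k]]]]]] //= _; rewrite !inE eqxx ?orbT.
Qed.

Section Families.
Variable F : fieldType.
Implicit Types i alpha beta gamma : F.

Definition E14 : nalgType F := evol5 (e_ 5) (e_ 5) (e_ 5) (e_ 5) 0.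

Definition E131_1 : nalgType F := evol5 (e_ 2) (e_ 5) (e_ 5) (e_ 5) 0.
Definition E131_2 i : nalgType F :=
  evol5 (e_ 2 + i *: e_ 3) (e_ 5) (e_ 5) (e_ 5) 0.

Definition E113_1 : nalgType F := evol5 (e_ 4) (e_ 4) (e_ 4) (e_ 5) 0.
Definition E113_2 : nalgType F := evol5 (e_ 4) (e_ 4) (e_ 4 + e_ 5) (e_ 5) 0.
Definition E113_3 alpha : nalgType F :=
  evol5 (e_ 4 + alpha *: e_ 5) (e_ 4) (e_ 4 + e_ 5) (e_ 5) 0.

Definition E1112_1 : nalgType F := evol5 (e_ 3) (e_ 3) (e_ 4) (e_ 5) 0.
Definition E1112_2 : nalgType F := evol5 (e_ 3 + e_ 5) (e_ 3) (e_ 4) (e_ 5) 0.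
Definition E1112_3 gamma : nalgType F :=
  evol5 (e_ 3 + e_ 4 + gamma *: e_ 5) (e_ 3) (e_ 4) (e_ 5) 0.
Definition E1112_4 beta gamma : nalgType F :=
  evol5 (e_ 3 + e_ 4 + gamma *: e_ 5) (e_ 3 + beta *: e_ 4) (e_ 4) (e_ 5) 0.

End Families.
Arguments E14 {F}.
Arguments E131_1 {F}.
Arguments E113_1 {F}.
Arguments E113_2 {F}.
Arguments E1112_1 {F}.
Arguments E1112_2 {F}.

(* Main.v *)
Require Import Defs.
From HB Require Import structures.
From mathcomp Require Import all_boot all_order all_algebra.
From mathcomp Require Import ring.

(******************************************************************************)
(* The terms of the annihilator series of an evolution algebra are spanned by *)
(* parts of any natural basis. Sorting the basis by level makes the squares   *)
(* strictly triangular, with zero and nonzero coefficients prescribed by the  *)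
(* type; in the four types considered the annihilator is a line, so that a    *)
(* morphism is injective as soon as it does not kill the last basis vector.   *)
(* Hence an isomorphism amounts to five vectors with a given product table.   *)
(* After rescaling, the algebra depends on:                                   *)
(* - for [1,3,1], a nonzero vector of a nondegenerate quadratic space of      *)
(*   dimension 3, up to isometry and scaling: it is isotropic or not;         *)
(* - for [1,1,3], three scalars b_k (e_k^2 = e_4 + b_k e_5), up to            *)
(*   permutations and affine maps;                                            *)
(* - for [1,1,1,2], two pairs (b_k, c_k) (e_k^2 = e_3 + b_k e_4 + c_k e_5),   *)
(*   up to permutation and maps (b, c) |-> (x b, t + x^3 c).                  *)
(* In the last two cases the coordinates of an isomorphism on the top layer   *)
(* form a multiple M of an orthogonal matrix which intertwines the diagonal   *)
(* matrices of parameters: M j l != 0 forces the corresponding parameters to  *)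
(* match, so the set of parameters is an invariant up to the maps above.      *)
(******************************************************************************)

Set Implicit Arguments.
Unset Strict Implicit.
Unset Printing Implicit Defensive.

Import GRing.Theory.
Local Open Scope ring_scope.

(** A natural basis is compatible with the annihilator series: x lies in a term exactly when every
    basis vector in its support does ([memv_ann_series]). For a basis sorted by level, the type
    therefore dictates which structure constants vanish and which squares must leave a given term
    ([tri5_of_type]). Square roots in F then normalize most of the remaining constants.

    Existence of normal forms comes from explicit vectors: by [isomorphic_tri5], it is enough to
    find five vectors with the required product table, the last one nonzero, and the table is
    checked by polynomial identities. The vectors come from completing e_1^2 to an orthogonal frame
    (type [1,3,1]), or from rescaling and shifting by elements of the annihilator (types [1,1,3] and
    [1,1,1,2]).

    Separation for [1,1,3] and [1,1,1,2] rests on [orthogonal_pencil]: on the top layer an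
    isomorphism is a matrix M with M M^T scalar that carries one diagonal matrix of parameters to
    another, so the two parameter sets correspond under an affine or weighted map
    ([tri113_invariant], [tri1112_invariant]). Comparing sets of at most three elements is then a
    finite case analysis. For [1,3,1], the identity x^2 x^2 = 0 detects that e_1^2 is isotropic. *)

Section Isomorphism.
Variable F : fieldType.
Implicit Types A B C E : nalgType F.

Lemma isomorphic_sym A B : isomorphic A B -> isomorphic B A.
Proof.
case=> f [kf imf fM].
have fK : cancel f (f^-1)%VF by apply: lker0_lfunK; apply/eqP.
have fVK y : f ((f^-1)%VF y) = y by rewrite limg_lfunVK ?imf ?memvf.
exists (f^-1)%VF; split.
- apply/eqP; rewrite -subv0; apply/subvP=> y; rewrite memv_ker => /eqP h.
  by rewrite memv0 -(fVK y) h linear0.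
- apply/eqP; rewrite eqEsubv subvf /=; apply/subvP=> x _.
  by rewrite -(fK x) memv_img ?memvf.
- by move=> x y; rewrite -{1}(fVK x) -{1}(fVK y) -fM fK.
Qed.

Lemma isomorphic_trans A B C :
  isomorphic A B -> isomorphic B C -> isomorphic A C.
Proof.
case=> f [kf imf fM] [g [kg img gM]]; exists (g \o f)%VF; split.
- apply/eqP; rewrite -subv0; apply/subvP=> x.
  rewrite memv_ker lfunE /= -memv_ker kg memv0 -memv0 -kf memv_ker.
  by rewrite memv0.
- by rewrite limg_comp imf img.
- by move=> x y; rewrite !lfunE /= fM gM.
Qed.

End Isomorphism.

(** * Isomorphisms onto strictly triangular evolution algebras *)

Section TriangularEvolution.
Variables (F : fieldType) (n : nat) (sq : 'I_n.+1 -> 'rV[F]_n.+1).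
Hypothesis sq_tri : forall k l, sq k 0 l != 0 -> (k < l)%N.
Hypothesis sq_neq0 : forall k : 'I_n.+1, (k < n)%N -> sq k != 0.

(* A nonzero ideal of such an algebra contains its last basis vector, so that *)
(* a morphism which does not kill this vector is injective.                   *)
Lemma isomorphic_evolP (E : nalgType F) : \dim {:E} = n.+1 ->
  isomorphic E (evol_alg sq) <->
  exists2 v : 'I_n.+1 -> E, v ord_max != 0 &
    forall j k, amul (v j) (v k) =
                if j == k then \sum_l sq j 0 l *: v l else 0.
Proof.
move=> dimE; split=> [/isomorphic_sym[f [kf _ fM]] | [v v_max vM]].
  exists (fun k => f (delta_mx 0 k)).
    apply/eqP=> /eqP; rewrite -memv_ker kf memv0 => /eqP/rowP/(_ ord_max).
    by rewrite !mxE !eqxx => /eqP; rewrite oner_eq0.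
  move=> j k; rewrite -fM /amul /= /evol_mul.
  transitivity (f (if j == k then sq j else 0)).
    congr (f _); rewrite (bigD1 j) //= big1 ?addr0 => [|l lj].
      rewrite !mxE !eqxx mul1r /=.
      by have [] := eqVneq j k; rewrite ?scale1r ?scale0r.
    by rewrite !mxE /= (negbTE lj) mul0r scale0r.
  case: eqP => // _; last by rewrite linear0.
  rewrite {1}[sq j]row_sum_delta linear_sum; apply: eq_bigr => l _.
  by rewrite linearZ.
pose h (x : evol_alg sq) : E := \sum_k (x : 'rV_n.+1) 0 k *: v k.
have h_lin : linear h.
  move=> a x y; rewrite /h scaler_sumr -big_split; apply: eq_bigr => k _ /=.
  by rewrite scalerA -scalerDl !mxE.
pose hL := GRing.isLinear.Build _ _ _ _ h h_lin.
pose g := linfun (HB.pack h hL : {linear _ -> _}).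
have gE x : g x = h x by rewrite lfunE.
have gM x y : g (amul x y) = amul (g x) (g y).
  rewrite !gE /h linear_sumlz /amul /= /evol_mul.
  under [RHS]eq_bigr => k _.
    rewrite linear_sumr (bigD1 k) //= big1 ?addr0 => [|l lk]; last first.
      by rewrite linearZl_LR linearZr_LR /= vM eq_sym (negbTE lk) !scaler0.
    rewrite linearZl_LR linearZr_LR /= vM eqxx scalerA scaler_sumr; over.
  rewrite exchange_big; apply: eq_bigr => l _ /=; rewrite summxE scaler_suml.
  by apply: eq_bigr => k _; rewrite mxE scalerA.
have h_delta k : h (delta_mx 0 k : 'rV_n.+1) = v k.
  rewrite /h (bigD1 k) //= big1 ?addr0 => [|l lk]; rewrite !mxE ?eqxx ?scale1r //.
  by rewrite (negbTE lk) scale0r.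
(* Induction on the distance m from the support of x to the last index. If h kills x, it also kills
   x e_k = x_k e_k^2, hence [sq k] for each k in the support. That row is supported strictly to the
   right of k, so it would be 0 by induction, which is impossible for k < n. *)
have gker m (x : 'rV[F]_n.+1) : h x = 0 ->
    (forall k : 'I_n.+1, x 0 k != 0 -> (n - k <= m)%N) -> x = 0.
  elim: m x => [|m IH] x hx supp.
    have supp0 k : k != ord_max -> x 0 k = 0.
      move=> kn; apply/eqP; apply: contraNT kn => /supp.
      rewrite leqn0 subn_eq0 -val_eqE /= eqn_leq => ->.
      by rewrite andbT -ltnS ltn_ord.
    have x_max : x 0 ord_max = 0.
      move: hx; rewrite /h (bigD1 ord_max) //= big1 ?addr0 => [/eqP|k /supp0->].
        by rewrite scaler_eq0 (negbTE v_max) orbF => /eqP.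
      by rewrite scale0r.
    by apply/rowP=> k; rewrite mxE; case: (eqVneq k ord_max) => [->|/supp0].
  have sq_ker k : x 0 k != 0 -> h (sq k) = 0.
    move=> xk; apply/eqP; have /eqP := gM x (delta_mx 0 k : 'rV_n.+1).
    rewrite [g x]gE hx linear0l gE /amul /= /evol_mul (bigD1 k) //= big1.
      rewrite addr0 mxE !eqxx mulr1 -gE linearZ scaler_eq0 (negbTE xk) /=.
      by rewrite gE.
    by move=> l lk; rewrite mxE (negbTE lk) andbF mulr0 scale0r.
  apply: (IH) => // k xk; rewrite leqNgt; apply/negP=> nk.
  have kn : (k < n)%N by rewrite -subn_gt0; case: (n - k)%N nk.
  case/negP: (sq_neq0 kn); apply/eqP/IH; first exact: sq_ker.
  move=> l /sq_tri kl; have := supp k xk.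
  by rewrite !leq_subLR => /leq_trans; apply; rewrite addnS -addSn leq_add2r.
apply: isomorphic_sym; exists g; split=> //.
  apply/eqP; rewrite -subv0; apply/subvP=> x; rewrite memv_ker gE memv0.
  by move=> /eqP/gker-/(_ n) -> // k _; rewrite leq_subr.
apply/eqP; rewrite eqEdim subvf /= dimE limg_dim_eq.
  by rewrite dimvf /dim /= mul1n.
apply/eqP; rewrite -subv0 capfv; apply/subvP=> x; rewrite memv_ker gE memv0.
by move=> /eqP/gker-/(_ n) -> // k _; rewrite leq_subr.
Qed.

End TriangularEvolution.

(** * Natural bases and the annihilator series *)

Section NaturalBasis.
Variables (F : fieldType) (E : nalgType F) (n : nat) (X : n.-tuple E).
Hypothesis X_basis : basis_of fullv X.
Hypothesis X_orth : forall j k : 'I_n, j != k -> amul X`_j X`_k = 0.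

Let coordE x : x = \sum_k coord X k x *: X`_k.
Proof. by apply: coord_basis X_basis _; rewrite memvf. Qed.

Let coordX (j k : 'I_n) : coord X j X`_k = (j == k)%:R.
Proof. by rewrite coord_free ?(basis_free X_basis) // eq_sym. Qed.

Lemma amul_natural_basis x y :
  amul x y = \sum_k (coord X k x * coord X k y) *: amul X`_k X`_k.
Proof.
rewrite {1}[x]coordE linear_sumlz; apply: eq_bigr => k _.
rewrite {1}[y]coordE linear_sumr (bigD1 k) //= big1 ?addr0 => [|l lk].
  by rewrite linearZl_LR linearZr_LR /= scalerA.
by rewrite linearZl_LR linearZr_LR /= X_orth ?scaler0 // eq_sym.
Qed.

(** Multiplying x by a basis vector isolates one coordinate: x X_k = x_k X_k^2. Membership is thus
    decided coordinate by coordinate, whatever the subspace U. *)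
Lemma memv_ann_mod_natural (U : {vspace E}) x :
  x \in ann_mod U <->
  forall k : 'I_n, coord X k x != 0 -> amul X`_k X`_k \in U.
Proof.
split=> [/memv_ann_mod xU k xk | xU].
  have [] := xU X`_k; rewrite amul_natural_basis (bigD1 k) //= big1.
    by rewrite addr0 coordX eqxx mulr1 rpredZeq (negbTE xk).
  by move=> l lk; rewrite coordX (negbTE lk) mulr0 scale0r.
apply/memv_ann_mod=> y; suff xy z : amul x z \in U /\ amul z x \in U by exact: xy.
by rewrite !amul_natural_basis; split; apply: memv_suml => k _;
  have [->|/xU/memvZ//] := eqVneq (coord X k x) 0;
  rewrite ?(mulr0, mul0r) scale0r mem0v.
Qed.

Lemma mem_natural_basis_ann (j : nat) (k : 'I_n) :
  (X`_k \in ann_series E j.+1) = (amul X`_k X`_k \in ann_series E j).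
Proof.
apply/idP/idP=> [/memv_ann_mod_natural/(_ k)|XkU].
  by rewrite coordX eqxx oner_eq0; apply.
apply/memv_ann_mod_natural => l; rewrite coordX.
by have [->|] := eqVneq l k; rewrite ?eqxx.
Qed.

Lemma memv_ann_series j x :
  x \in ann_series E j <->
  forall k : 'I_n, coord X k x != 0 -> X`_k \in ann_series E j.
Proof.
split=> [|xA]; last first.
  rewrite [x]coordE; apply: memv_suml => k _.
  have [->|/xA/memvZ//] := eqVneq (coord X k x) 0; by rewrite scale0r mem0v.
case: j => [|j].
  by rewrite memv0 => /eqP-> k; rewrite linear0 eqxx.
by move=> /memv_ann_mod_natural xA k /xA; rewrite mem_natural_basis_ann.
Qed.

(** By [memv_ann_series], the basis vectors that lie in a term span it, and they are free. *)
Lemma dim_ann_series j :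
  \dim (ann_series E j) = count [in ann_series E j] X.
Proof.
set A := ann_series E j; pose Y := [seq x <- X | x \in A].
have freeY : free Y by apply: filter_free; apply: basis_free X_basis.
rewrite -size_filter -/Y -(eqnP freeY); congr (\dim _).
apply/eqP; rewrite eqEsubv; apply/andP; split; apply/subvP=> x; last first.
  by apply/subvP/span_subvP=> y; rewrite mem_filter => /andP[].
move=> /memv_ann_series xA; rewrite [x]coordE; apply: memv_suml => k _.
have [->|xk] := eqVneq (coord X k x) 0; first by rewrite scale0r mem0v.
by apply/memvZ/memv_span; rewrite mem_filter [_ \in A]xA // mem_nth ?size_tuple.
Qed.

End NaturalBasis.

Section AnnihilatorSeries.
Variables (F : fieldType) (E : nalgType F).

Lemma ann_mod_subv (U V : {vspace E}) :
  (U <= V)%VS -> (ann_mod U <= ann_mod V)%VS.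
Proof.
move=> /subvP UV; apply/subvP=> x /memv_ann_mod xU.
by apply/memv_ann_mod=> y; have [/UV ? /UV] := xU y.
Qed.

Lemma ann_series_subv j k : (j <= k)%N -> (ann_series E j <= ann_series E k)%VS.
Proof.
move/subnK <-; elim: (k - j)%N => // m; rewrite addSn => /subv_trans; apply.
by elim: (m + j)%N => [|l /ann_mod_subv//]; exact: sub0v.
Qed.

Lemma dim_ann_series_type s j : has_type E s -> (j <= size s)%N ->
  \dim (ann_series E j) = sumn (take j s).
Proof.
case=> _ _ sE; elim: j => [|j IH] js; first by rewrite dimv0 take0.
rewrite (take_nth 0%N) // sumn_rcons -IH ?(ltnW js) // sE //.
by rewrite subnKC // dimvS // ann_series_subv.
Qed.

End AnnihilatorSeries.

(** A predicate that persists to the right holds on a suffix, and the length of this suffix is the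
    count. It turns membership in a term of the series into a bound on the index. *)
Lemma nth_count_mono (T : eqType) (x0 : T) (p : pred T) (s : seq T) :
  (forall i j, (i <= j < size s)%N -> p (nth x0 s i) -> p (nth x0 s j)) ->
  forall i, (i < size s)%N -> p (nth x0 s i) = (size s - count p s <= i)%N.
Proof.
elim: s => // x s IH p_mono i; have [px|npx] := boolP (p x).
  have all_p : all p (x :: s).
    by apply/(all_nthP x0) => k ks; apply: (p_mono 0%N).
  move=> i_s; rewrite (all_nthP x0 all_p) //.
  by move: all_p; rewrite all_count => /eqP->; rewrite subnn.
case: i => [|i] /= => [_|]; rewrite ?(negbTE npx) add0n.
  by apply/esym/negbTE; rewrite -ltnNge subn_gt0 ltnS count_size.
rewrite ltnS => i_s; rewrite IH // ?subSn ?count_size // => a b ab.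
exact: (p_mono a.+1 b.+1).
Qed.

(** The basis is sorted by the preorder [le], where x precedes y if every term of index at most r
    that contains x contains y. The preorder is total because the terms are nested, so each term is
    spanned by a suffix of the sorted basis. *)
Lemma sorted_natural_basis (F : fieldType) (E : nalgType F) n r :
  evolution_algebra E -> \dim {:E} = n ->
  exists X : n.-tuple E, [/\ basis_of fullv X,
    forall j k : 'I_n, j != k -> amul X`_j X`_k = 0
  & forall j (k : 'I_n), (j <= r)%N ->
      (X`_k \in ann_series E j) = (n - \dim (ann_series E j) <= k)%N].
Proof.
case=> b [b_basis b_orth] dimE; pose A := ann_series E.
pose le (x y : E) := all (fun j => (x \in A j) ==> (y \in A j)) (iota 0 r.+1).
have leP x y : reflect (forall j, (j <= r)%N -> x \in A j -> y \in A j) (le x y).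
  apply: (iffP allP) => xy j; last by rewrite mem_iota => jr; apply/implyP/xy.
  by move=> jr; apply/implyP/xy; rewrite mem_iota.
have le_total : total le.
  move=> x y; case: (leP x y) => //= nxy; apply/leP=> j jr yj.
  apply: contraT => nxj; case: nxy => k kr xk.
  have [jk|kj] := leqP j k; first by apply: (subvP (ann_series_subv _ jk)).
  by case/negP: nxj; apply: (subvP (ann_series_subv _ (ltnW kj))).
have le_trans : transitive le.
  by move=> y x z /leP xy /leP yz; apply/leP=> j jr /(xy j jr)/(yz j jr).
have le_refl : reflexive le by move=> x; apply/leP.
pose X := sort le b; have Xb : perm_eq X b by rewrite perm_sort.
have XB : basis_of fullv X by rewrite (perm_basis _ Xb).
have szX : size X == n.
  by rewrite -dimE -(eqnP (basis_free XB)) (span_basis XB).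
have sorted_X : sorted le X by apply: sort_sorted.
have b_orth' x y : x \in b -> y \in b -> x != y -> amul x y = 0.
  move=> /(nthP 0)[j jb <-] /(nthP 0)[k kb <-] jk; apply: b_orth => //.
  by apply: contraNneq jk => ->.
have X_orth (j k : 'I_n) : j != k -> amul X`_j X`_k = 0.
  move=> jk; apply: b_orth'; rewrite -?(perm_mem Xb) ?mem_nth ?(eqP szX) //.
  rewrite nth_uniq ?(eqP szX) //.
  exact: free_uniq (basis_free XB).
exists (Tuple szX); split=> // j k jr /=.
have jX : n = size X by rewrite (eqP szX).
rewrite (@dim_ann_series _ _ n (Tuple szX)) //= {2}jX.
rewrite -(@nth_count_mono _ 0 [in ann_series E j]) //; last by rewrite -jX.
move=> i l /andP[il lX].
have := sorted_leq_nth le_trans le_refl 0 sorted_X; move/(_ i l).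
by rewrite !inE lX (leq_ltn_trans il lX) => /(_ isT isT il)/leP; apply.
Qed.

(* The natural basis is sorted by decreasing level in the annihilator series: *)
(* its last [\dim (ann_series E j)] elements span [ann_series E j].           *)
Lemma natural_basis_of_type (F : fieldType) (E : nalgType F) n s :
  evolution_algebra E -> \dim {:E} = n -> has_type E s ->
  exists (X : 'I_n -> E) (sq : 'I_n -> 'rV[F]_n),
    [/\ forall k, X k != 0,
        forall j k, amul (X j) (X k) =
                    if j == k then \sum_l sq j 0 l *: X l else 0,
        forall k l, sq k 0 l != 0 -> (k < l)%N
      & forall j (k : 'I_n), (j < size s)%N ->
          if (n - sumn (take j.+1 s) <= k)%N
          then forall l : 'I_n, (l < n - sumn (take j s))%N -> sq k 0 l = 0
          else exists2 l : 'I_n, (l < n - sumn (take j s))%N & sq k 0 l != 0].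
Proof.
move=> evE dimE typE.
have [X [XB X_orth X_lev]] := sorted_natural_basis (size s) evE dimE.
pose sq (k : 'I_n) : 'rV[F]_n := \row_l coord X l (amul X`_k X`_k).
have sqE j (k : 'I_n) : (j < size s)%N ->
          (n - sumn (take j.+1 s) <= k)%N =
          [forall l, (sq k 0 l != 0) ==> (n - sumn (take j s) <= l)%N].
  move=> js; rewrite -!(dim_ann_series_type typE) ?(ltnW js) //.
  rewrite -X_lev // (mem_natural_basis_ann XB X_orth).
  apply/idP/forallP => [/(memv_ann_series XB X_orth) h l|h].
    by apply/implyP; rewrite mxE -X_lev ?(ltnW js) //; apply: h.
  apply/(memv_ann_series XB X_orth) => l hl; rewrite X_lev ?(ltnW js) //.
  by apply: (implyP (h l)); rewrite mxE.
exists (fun k => X`_k), sq; split=> //; last 1 first.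
- move=> j k js; rewrite sqE //; case: ifPn => [/forallP h l|].
    by rewrite ltnNge; apply: contraNeq => kl; apply: (implyP (h l)).
  rewrite negb_forall => /existsP[l]; rewrite negb_imply -ltnNge => /andP[? ?].
  by exists l.
- by move=> k; apply: free_not0 (basis_free XB) _; rewrite mem_nth ?size_tuple.
- move=> j k; have [<-|/X_orth//] := eqVneq j k.
  rewrite [LHS](coord_basis XB (memvf _)).
  by apply: eq_bigr => l _; rewrite mxE.
- move=> k l kl; have [Efull _ _] := typE.
  have := dim_ann_series_type typE (leqnn _); rewrite Efull dimE.
  (* At the least j such that X_k lies in term j+1, the square of X_k lies in term j, whose suffix
     starts strictly after k. *)
  suff lev j : (j <= size s)%N -> (n - sumn (take j s) <= k)%N -> (k < l)%N.
    by move=> Es; apply: (lev (size s)) => //; rewrite -Es subnn.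
  elim: j => [|j IH] js; first by rewrite take0 subn0 leqNgt ltn_ord.
  have [+ _|kj] := leqP (n - sumn (take j s)) k; first by apply/IH/ltnW.
  rewrite sqE // => /forallP/(_ l); rewrite kl /=; exact: leq_trans.
Qed.

(** * Strictly triangular five-dimensional algebras *)

Definition vec5 (F : fieldType) (a1 a2 a3 a4 a5 : F) : 'rV[F]_5 :=
  \row_(j < 5) [:: a1; a2; a3; a4; a5]`_j.

Definition tri5 (F : fieldType) (a12 a13 a14 a15 a23 a24 a25 a34 a35 a45 : F) :=
  evol5 (vec5 0 a12 a13 a14 a15) (vec5 0 0 a23 a24 a25) (vec5 0 0 0 a34 a35)
        (vec5 0 0 0 0 a45) 0.

Section Dimension5.
Variable F : fieldType.
Implicit Types a b c d x y : F.

Lemma vec5D a1 a2 a3 a4 a5 b1 b2 b3 b4 b5 :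
  vec5 a1 a2 a3 a4 a5 + vec5 b1 b2 b3 b4 b5 =
  vec5 (a1 + b1) (a2 + b2) (a3 + b3) (a4 + b4) (a5 + b5).
Proof. by apply/rowP=> -[[|[|[|[|[|//]]]]] ?]; rewrite !mxE. Qed.

Lemma vec5Z c a1 a2 a3 a4 a5 :
  c *: vec5 a1 a2 a3 a4 a5 = vec5 (c * a1) (c * a2) (c * a3) (c * a4) (c * a5).
Proof. by apply/rowP=> -[[|[|[|[|[|//]]]]] ?]; rewrite !mxE. Qed.

Lemma vec5_0 : 0 = vec5 0 0 0 0 0 :> 'rV[F]_5.
Proof. by apply/rowP=> -[[|[|[|[|[|//]]]]] ?]; rewrite !mxE. Qed.

Lemma std_basis5E k :
  e_ k = vec5 (1 == k)%:R (2 == k)%:R (3 == k)%:R (4 == k)%:R (5 == k)%:R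
    :> 'rV[F]_5.
Proof. by apply/rowP=> -[[|[|[|[|[|//]]]]] ?]; rewrite !mxE. Qed.

Lemma vec5_inj a1 a2 a3 a4 a5 b1 b2 b3 b4 b5 :
  vec5 a1 a2 a3 a4 a5 = vec5 b1 b2 b3 b4 b5 ->
  [/\ a1 = b1, a2 = b2, a3 = b3, a4 = b4 & a5 = b5].
Proof.
move/rowP=> h; split.
- by have := h (@Ordinal 5 0 isT); rewrite !mxE.
- by have := h (@Ordinal 5 1 isT); rewrite !mxE.
- by have := h (@Ordinal 5 2 isT); rewrite !mxE.
- by have := h (@Ordinal 5 3 isT); rewrite !mxE.
- by have := h (@Ordinal 5 4 isT); rewrite !mxE.
Qed.

Lemma vec5_eta (v : 'rV[F]_5) :
  v = vec5 (v 0 (inord 0)) (v 0 (inord 1)) (v 0 (inord 2)) (v 0 (inord 3))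
           (v 0 (inord 4)).
Proof.
by apply/rowP=> -[[|[|[|[|[|//]]]]] ?]; rewrite !mxE /=; congr (v 0 _);
  apply: val_inj; rewrite /= inordK.
Qed.

Lemma vec5_eq0 a1 a2 a3 a4 a5 :
  (vec5 a1 a2 a3 a4 a5 == 0) = [&& a1 == 0, a2 == 0, a3 == 0, a4 == 0 & a5 == 0].
Proof.
rewrite vec5_0; apply/eqP/and5P=> [/vec5_inj[-> -> -> -> ->] //|].
by case=> /eqP-> /eqP-> /eqP-> /eqP-> /eqP->.
Qed.

Lemma sum_ord5 (V : nmodType) (G : 'I_5 -> V) :
  \sum_l G l = G (@Ordinal 5 0 isT) + G (@Ordinal 5 1 isT)
    + G (@Ordinal 5 2 isT) + G (@Ordinal 5 3 isT) + G (@Ordinal 5 4 isT).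
Proof.
rewrite 5!big_ord_recr big_ord0 /= add0r.
by congr (_ + _ + _ + _ + _); congr (G _); apply: val_inj.
Qed.

Variables a12 a13 a14 a15 a23 a24 a25 a34 a35 a45 : F.
Let T := tri5 a12 a13 a14 a15 a23 a24 a25 a34 a35 a45.

Lemma tri5_mul x1 x2 x3 x4 x5 y1 y2 y3 y4 y5 :
  amul (vec5 x1 x2 x3 x4 x5 : T) (vec5 y1 y2 y3 y4 y5) =
  vec5 0 (x1 * y1 * a12) (x1 * y1 * a13 + x2 * y2 * a23)
    (x1 * y1 * a14 + x2 * y2 * a24 + x3 * y3 * a34)
    (x1 * y1 * a15 + x2 * y2 * a25 + x3 * y3 * a35 + x4 * y4 * a45).
Proof.
rewrite /amul /= /evol_mul sum_ord5 /= !mxE /= scaler0 addr0 !vec5Z !vec5D.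
by congr vec5; rewrite !mulr0 ?addr0 ?add0r.
Qed.

Hypothesis row1 : [|| a12 != 0, a13 != 0, a14 != 0 | a15 != 0].
Hypothesis row2 : [|| a23 != 0, a24 != 0 | a25 != 0].
Hypothesis row3 : (a34 != 0) || (a35 != 0).
Hypothesis row4 : a45 != 0.

Lemma isomorphic_tri5P (E : nalgType F) : \dim {:E} = 5%N ->
  isomorphic E T <->
  exists2 v : 'I_5 -> E, v ord_max != 0 &
    forall j k, amul (v j) (v k) =
      if j == k then
        \sum_l [:: vec5 0 a12 a13 a14 a15; vec5 0 0 a23 a24 a25;
                   vec5 0 0 0 a34 a35; vec5 0 0 0 0 a45; 0]`_j 0 l *: v l
      else 0.
Proof.
apply: isomorphic_evolP => [k l|k].
  case: k => [[|[|[|[|[|//]]]]] ?]; case: l => [[|[|[|[|[|//]]]]] ?];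
    by rewrite !mxE /= ?eqxx.
case: k => [[|[|[|[|[|//]]]]] ?] //= _;
  by rewrite vec5_eq0 !negb_and ?row1 ?row2 ?row3 ?row4 ?orbT.
Qed.

(** The necessary half of [isomorphic_tri5P], indexed by natural numbers so that indices compute.
    Counting starts at 0: [v k] plays the role of e_(k+1). *)
Lemma tri5_isomorphic (E : nalgType F) : \dim {:E} = 5%N ->
  isomorphic E T ->
  exists2 v : nat -> E, v 4 != 0 &
    forall j k, (j < 5)%N -> (k < 5)%N -> amul (v j) (v k) =
      if j == k then
        [:: a12 *: v 1 + a13 *: v 2 + a14 *: v 3 + a15 *: v 4;
            a23 *: v 2 + a24 *: v 3 + a25 *: v 4; a34 *: v 3 + a35 *: v 4;
            a45 *: v 4; 0]`_j
      else 0.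
Proof.
move=> dimE /(isomorphic_tri5P dimE)[v v_max vM].
exists (fun k => v (inord k)) => [|j k j5 k5].
  by rewrite (_ : inord 4 = ord_max) //; apply: val_inj; rewrite /= inordK.
rewrite vM -val_eqE /= !inordK //; case: eqP => // _.
under eq_bigr => l _ do rewrite -[v l]/(v l) -{2}[l]inord_val.
rewrite sum_ord5.
by case: j j5 => [|[|[|[|[|//]]]]] _; rewrite !mxE /=;
  rewrite ?scale0r ?add0r ?addr0.
Qed.

(** The vectors live in the source S and satisfy the product table of the target T. Commutativity
    supplies the products in the other order. *)
Lemma isomorphic_tri5
    b12 b13 b14 b15 b23 b24 b25 b34 b35 b45 (v1 v2 v3 v4 v5 : 'rV[F]_5) :
    let S := tri5 b12 b13 b14 b15 b23 b24 b25 b34 b35 b45 in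
    let mul := @amul F S in
    [/\ mul v1 v2 = 0, mul v1 v3 = 0, mul v1 v4 = 0, mul v1 v5 = 0
      & mul v2 v3 = 0] ->
    [/\ mul v2 v4 = 0, mul v2 v5 = 0, mul v3 v4 = 0, mul v3 v5 = 0
      & mul v4 v5 = 0] ->
    [/\ mul v1 v1 = a12 *: v2 + a13 *: v3 + a14 *: v4 + a15 *: v5,
        mul v2 v2 = a23 *: v3 + a24 *: v4 + a25 *: v5,
        mul v3 v3 = a34 *: v4 + a35 *: v5,
        mul v4 v4 = a45 *: v5 & mul v5 v5 = 0] ->
    v5 != 0 ->
  isomorphic S T.
Proof.
move=> S mul [h12 h13 h14 h15 h23] [h24 h25 h34 h35 h45].
move=> [h11 h22 h33 h44 h55] v5_neq0.
have mulC (x y : S) : mul x y = mul y x.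
  by rewrite /mul /amul /= /evol_mul; apply: eq_bigr => k _; rewrite mulrC.
apply/isomorphic_tri5P; first by rewrite dimvf /dim /= mul1n.
exists (fun k : 'I_5 => [:: v1; v2; v3; v4; v5]`_k) => //.
move=> [[|[|[|[|[|//]]]]] ?] [[|[|[|[|[|//]]]]] ?];
  rewrite -?val_eqE //= -/mul ?(mulC v2 v1) ?(mulC v3 v1) ?(mulC v3 v2)
    ?(mulC v4 v1) ?(mulC v4 v2) ?(mulC v4 v3) ?(mulC v5) //.
all: rewrite sum_ord5 !mxE /= ?scale0r ?add0r ?addr0 //.
Qed.

End Dimension5.

Arguments isomorphic_tri5 {F a12 a13 a14 a15 a23 a24 a25 a34 a35 a45}
  row1 row2 row3 row4 {b12 b13 b14 b15 b23 b24 b25 b34 b35 b45} v1 v2 v3 v4 v5.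

(** As [sumn (take j s)] is the dimension of term j, the vector e_k, counted from 1, lies in that
    term exactly when k > 5 - [sumn (take j s)]. Then e_k lies in term j+1 exactly when its square
    has no coordinate below the suffix of term j. A first entry 1 of the type means that only e_5 is
    annihilating, so that the other four squares are nonzero as [isomorphic_tri5P] requires. *)
Lemma tri5_of_type (F : fieldType) (E : nalgType F) s :
  evolution_algebra E -> \dim {:E} = 5%N -> has_type E s -> nth 0%N s 0 = 1%N ->
  exists a : nat -> nat -> F,
  isomorphic E (tri5 (a 1 2) (a 1 3) (a 1 4) (a 1 5) (a 2 3) (a 2 4) (a 2 5)
                     (a 3 4) (a 3 5) (a 4 5))%N
  /\ forall j k, (j < size s)%N -> (0 < k)%N ->
     ((5 - sumn (take j.+1 s) < k)%N ->
        forall l, (k < l <= 5 - sumn (take j s))%N -> a k l = 0) /\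
     ((k <= 5 - sumn (take j.+1 s))%N ->
        exists2 l, (k < l <= 5 - sumn (take j s))%N & a k l != 0).
Proof.
move=> evE dimE typE s1; have [X [sq [X0 XM sq_tri sq_lev]]] :=
  natural_basis_of_type evE dimE typE.
pose a (k l : nat) := sq (inord k.-1) 0 (inord l.-1); exists a.
have aE (k l : 'I_5) : a k.+1 l.+1 = sq k 0 l by rewrite /a /= !inord_val.
have lev j k : (j < size s)%N -> (0 < k <= 5)%N ->
     if (5 - sumn (take j.+1 s) < k)%N
     then forall l, (k < l <= 5 - sumn (take j s))%N -> a k l = 0
     else exists2 l, (k < l <= 5 - sumn (take j s))%N & a k l != 0.
  case: k => // k js /= k5; have := sq_lev j (Ordinal k5) js => /=.
  rewrite ltnS; case: ifP => _ => [h l /andP[]|[l l5 kl]].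
    case: l => // l kl l5.
    have l_lt5 : (l < 5)%N by apply: leq_trans l5 _; rewrite leq_subr.
    by have := aE (Ordinal k5) (Ordinal l_lt5); rewrite h //=.
  exists l.+1; rewrite ?ltnS ?(sq_tri _ _ kl) //.
  by rewrite (aE (Ordinal k5) l).
have row k : (0 < k < 5)%N -> exists2 l, (k < l <= 5)%N & a k l != 0.
  move=> /andP[k0 k5]; case: s s1 {typE sq_lev} lev => //= n s -> lev.
  have := lev 0%N k isT; rewrite k0 (ltnW k5) /= take0 leqNgt k5.
  exact.
split; last first.
  move=> j k js k0; split=> [lt_k l /andP[kl l5]|le_k].
    have := lev j k js; rewrite k0 lt_k (leq_trans (ltnW kl)); first last.
      by apply: leq_trans l5 _; rewrite leq_subr.
    by apply; rewrite ?kl.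
  have := lev j k js; rewrite k0 (leq_trans le_k) ?leq_subr // ltnNge le_k.
  exact.
apply/isomorphic_tri5P => //.
- by have [] := row 1%N isT; do 6?[case=> //]; move=> _ ->; rewrite ?orbT.
- by have [] := row 2%N isT; do 6?[case=> //]; move=> _ ->; rewrite ?orbT.
- by have [] := row 3%N isT; do 6?[case=> //]; move=> _ ->; rewrite ?orbT.
- by have [] := row 4%N isT; do 6?[case=> //]; move=> _ ->; rewrite ?orbT.
exists X; first exact: X0.
move=> j k; rewrite XM; case: eqP => // _; apply: eq_bigr => l _.
congr (_ *: _); rewrite -(aE j l).
have tri (m p : 'I_5) : (p <= m)%N -> a m.+1 p.+1 = 0.
  by rewrite aE; have [->|/sq_tri] := eqVneq (sq m 0 p) 0; rewrite // ltnNge => /negbTE->.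
by case: j l => [[|[|[|[|[|//]]]]] j5] [[|[|[|[|[|//]]]]] l5]; rewrite !mxE //=;
  have := tri (Ordinal j5) (Ordinal l5) => /= ->.
Qed.

(** * Structure constants forced by the four types *)

Section Shapes.
Variables (F : fieldType) (E : nalgType F).
Hypotheses (evE : evolution_algebra E) (dimE : \dim {:E} = 5%N).

Lemma tri5_of_type14 : has_type E [:: 1; 4]%N ->
  exists c1 c2 c3 c4, [/\ c1 != 0, c2 != 0, c3 != 0, c4 != 0
    & isomorphic E (tri5 0 0 0 c1 0 0 c2 0 c3 c4)].
Proof.
move=> typE; have [//|b [isoE lev]] := tri5_of_type evE dimE typE.
have z k l : (0 < k < l)%N -> (l <= 4)%N -> b k l = 0.
  move=> /andP[k0 kl] l4; by have [->] := lev 1%N k isT k0; rewrite ?kl.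
have nz k : (0 < k <= 4)%N -> b k 5 != 0.
  move=> /andP[k0 k4]; have [_ []] := lev 0%N k isT k0 => // l /andP[kl].
  by rewrite leq_eqVlt => /predU1P[-> //|l4]; rewrite z ?eqxx // k0.
exists (b 1 5)%N, (b 2 5)%N, (b 3 5)%N, (b 4 5)%N; split; rewrite ?nz //.
by rewrite !(z _ 2%N) // !(z _ 3%N) // !(z _ 4%N) // in isoE.
Qed.

Lemma tri5_of_type131 : has_type E [:: 1; 3; 1]%N ->
  exists a2 a3 a4 a5 c2 c3 c4,
    [/\ [|| a2 != 0, a3 != 0 | a4 != 0], c2 != 0, c3 != 0, c4 != 0
    & isomorphic E (tri5 a2 a3 a4 a5 0 0 c2 0 c3 c4)].
Proof.
move=> typE; have [//|b [isoE lev]] := tri5_of_type evE dimE typE.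
have z k l : (1 < k < l)%N -> (l <= 4)%N -> b k l = 0.
  move=> /andP[k0 kl] l4; by have [->] := lev 1%N k isT (ltnW k0); rewrite ?kl.
have nz k : (1 < k <= 4)%N -> b k 5 != 0.
  move=> /andP[k0 k4]; have [_ []] := lev 0%N k isT (ltnW k0) => // l /andP[kl].
  by rewrite leq_eqVlt => /predU1P[-> //|l4]; rewrite z ?eqxx // k0.
exists (b 1 2)%N, (b 1 3)%N, (b 1 4)%N, (b 1 5)%N, (b 2 5)%N, (b 3 5)%N, (b 4 5)%N.
split; rewrite ?nz //;
  last by rewrite (z 2 3)%N // (z 2 4)%N // (z 3 4)%N in isoE.
have [_ []] := lev 1%N 1%N isT isT => //.
by do 5?[case=> //]; move=> _ ->; rewrite ?orbT.
Qed.

Lemma tri5_of_type113 : has_type E [:: 1; 1; 3]%N ->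
  exists a1 b1 a2 b2 a3 b3 c, [/\ a1 != 0, a2 != 0, a3 != 0, c != 0
    & isomorphic E (tri5 0 0 a1 b1 0 a2 b2 a3 b3 c)].
Proof.
move=> typE; have [//|b [isoE lev]] := tri5_of_type evE dimE typE.
have z k l : (0 < k < l)%N -> (l <= 3)%N -> b k l = 0.
  move=> /andP[k0 kl] l4; by have [->] := lev 2%N k isT k0; rewrite ?kl.
have nz k : (0 < k <= 3)%N -> b k 4 != 0.
  move=> /andP[k0 k4]; have [_ []] := lev 1%N k isT k0 => // l /andP[kl].
  by rewrite leq_eqVlt => /predU1P[-> //|l4]; rewrite z ?eqxx // k0.
exists (b 1 4)%N, (b 1 5)%N, (b 2 4)%N, (b 2 5)%N, (b 3 4)%N, (b 3 5)%N, (b 4 5)%N.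
split; rewrite ?nz //; last by rewrite !(z _ 2%N) // !(z _ 3%N) // in isoE.
by have [_ []] := lev 0%N 4%N isT isT => //; do 6?[case=> //].
Qed.

Lemma tri5_of_type1112 : has_type E [:: 1; 1; 1; 2]%N ->
  exists a1 b1 c1 a2 b2 c2 a3 b3 c, [/\ a1 != 0, a2 != 0, a3 != 0, c != 0
    & isomorphic E (tri5 0 a1 b1 c1 a2 b2 c2 a3 b3 c)].
Proof.
move=> typE; have [//|b [isoE lev]] := tri5_of_type evE dimE typE.
have z : b 1%N 2%N = 0 by have [->] := lev 3%N 1%N isT isT.
exists (b 1 3)%N, (b 1 4)%N, (b 1 5)%N, (b 2 3)%N, (b 2 4)%N, (b 2 5)%N,
  (b 3 4)%N, (b 3 5)%N, (b 4 5)%N.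
split; last by rewrite z in isoE.
- have [_ []] := lev 2%N 1%N isT isT => //; do 4?[case=> //] => _; by rewrite z eqxx.
- by have [_ []] := lev 2%N 2%N isT isT => //; do 5?[case=> //].
- by have [_ []] := lev 1%N 3%N isT isT => //; do 6?[case=> //].
- by have [_ []] := lev 0%N 4%N isT isT => //; do 7?[case=> //].
Qed.

End Shapes.

(** * Normal forms *)

Ltac tri5_by tac :=
  rewrite ?vec5_eq0 ?negb_and ?oner_eq0 ?orbT //;
  split; rewrite ?tri5_mul ?vec5Z ?vec5D ?[0 in RHS]vec5_0; congr vec5; tac.

Section NormalForms.
Variable F : closedFieldType.
Implicit Types a b c q r x y t : F.

Lemma sqrt_exists c : exists r : F, r ^+ 2 = c.
Proof.
have [r rE] := @solve_monicpoly F 2 (fun k => if k is 0%N then c else 0) isT.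
exists r; rewrite rE big_ord_recl big_ord1 /= mulr1 mul0r addr0 //.
Qed.

Lemma rsqrt_exists c : c != 0 -> exists2 r : F, r != 0 & r ^+ 2 * c = 1.
Proof.
move=> c0; have [r rE] := sqrt_exists c^-1.
have r0 : r != 0 by rewrite -sqrf_eq0 rE invr_eq0.
by exists r; rewrite // rE mulVf.
Qed.

Lemma cbrt_exists c : exists r : F, r ^+ 3 = c.
Proof.
have [r rE] := @solve_monicpoly F 3 (fun k => if k is 0%N then c else 0) isT.
by exists r; rewrite rE !big_ord_recl big_ord0 /= mulr1 !mul0r !addr0.
Qed.

Lemma tri5_14_iso c1 c2 c3 c4 : c1 != 0 -> c2 != 0 -> c3 != 0 -> c4 != 0 ->
  isomorphic (tri5 0 0 0 c1 0 0 c2 0 c3 c4) (tri5 0 0 0 1 0 0 1 0 1 1).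
Proof.
move=> /rsqrt_exists[r1 _ r1E] /rsqrt_exists[r2 _ r2E].
move=> /rsqrt_exists[r3 _ r3E] /rsqrt_exists[r4 _ r4E].
apply: (isomorphic_tri5 _ _ _ _ (vec5 r1 0 0 0 0) (vec5 0 r2 0 0 0)
  (vec5 0 0 r3 0 0) (vec5 0 0 0 r4 0) (vec5 0 0 0 0 1));
  tri5_by ltac:(ring: r1E r2E r3E r4E).
Qed.

(** * Type [1,3,1]: the quadratic space spanned by e_2, e_3, e_4 *)

Section Type131.

Let T a2 a3 a4 a5 := tri5 a2 a3 a4 a5 0 0 1 0 1 1.

Lemma tri5_131_normalize a2 a3 a4 a5 c2 c3 c4 :
    [|| a2 != 0, a3 != 0 | a4 != 0] -> c2 != 0 -> c3 != 0 -> c4 != 0 ->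
  exists b2 b3 b4 b5, [|| b2 != 0, b3 != 0 | b4 != 0] /\
    isomorphic (tri5 a2 a3 a4 a5 0 0 c2 0 c3 c4) (T b2 b3 b4 b5).
Proof.
move=> a0 /rsqrt_exists[r2 r20 r2E].
move=> /rsqrt_exists[r3 r30 r3E] /rsqrt_exists[r4 r40 r4E].
have b0 : [|| a2 / r2 != 0, a3 / r3 != 0 | a4 / r4 != 0].
  by rewrite !mulf_eq0 !invr_eq0 (negbTE r20) (negbTE r30) (negbTE r40) !orbF.
exists (a2 / r2), (a3 / r3), (a4 / r4), a5; split=> //.
apply: (isomorphic_tri5 _ _ _ _ (vec5 1 0 0 0 0) (vec5 0 r2 0 0 0)
  (vec5 0 0 r3 0 0) (vec5 0 0 0 r4 0) (vec5 0 0 0 0 1)).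
  by rewrite !orbA -orbA in b0 *; rewrite b0.
all: tri5_by ltac:(field: r2E r3E r4E; by rewrite ?r20 ?r30 ?r40).
Qed.

Lemma tri5_131_swap23 a2 a3 a4 a5 : [|| a2 != 0, a3 != 0, a4 != 0 | a5 != 0] ->
  isomorphic (T a2 a3 a4 a5) (T a3 a2 a4 a5).
Proof.
move=> a0; apply: (isomorphic_tri5 _ _ _ _ (vec5 1 0 0 0 0) (vec5 0 0 1 0 0)
  (vec5 0 1 0 0 0) (vec5 0 0 0 1 0) (vec5 0 0 0 0 1)).
  by case/or4P: a0 => ->; rewrite ?orbT.
all: tri5_by ltac:(ring).
Qed.

Lemma tri5_131_swap34 a2 a3 a4 a5 : [|| a2 != 0, a3 != 0, a4 != 0 | a5 != 0] ->
  isomorphic (T a2 a3 a4 a5) (T a2 a4 a3 a5).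
Proof.
move=> a0; apply: (isomorphic_tri5 _ _ _ _ (vec5 1 0 0 0 0) (vec5 0 1 0 0 0)
  (vec5 0 0 0 1 0) (vec5 0 0 1 0 0) (vec5 0 0 0 0 1)).
  by case/or4P: a0 => ->; rewrite ?orbT.
all: tri5_by ltac:(ring).
Qed.

(** Modulo e_5, the square of e_1 is a = (a2, a3, a4), of norm q for the form with orthonormal basis
    e_2, e_3, e_4. Since p != 0, the vector (-a3, a2, 0) orthogonal to a is anisotropic. Suitable
    multiples of it and of (a2 a4, a3 a4, -p) complete a to an orthogonal frame all of norm q, and q
    e_5 becomes the last basis vector. *)
Lemma tri5_131_anisotropic a2 a3 a4 a5 :
    a2 ^+ 2 + a3 ^+ 2 != 0 -> a2 ^+ 2 + a3 ^+ 2 + a4 ^+ 2 != 0 ->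
  isomorphic (T a2 a3 a4 a5) (T 1 0 0 0).
Proof.
move pE: (a2 ^+ 2 + _) => p p0; move qE: (p + _) => q q0.
have [u _ uE] := rsqrt_exists p0; have [r rE] := sqrt_exists q.
have a3E : a3 ^+ 2 = p - a2 ^+ 2 by rewrite -pE; ring.
have a4E : a4 ^+ 2 = q - p by rewrite -qE; ring.
apply: (isomorphic_tri5 _ _ _ _ (vec5 1 0 0 0 0) (vec5 0 a2 a3 a4 a5)
  (vec5 0 (- (u * r * a3)) (u * r * a2) 0 0)
  (vec5 0 (u * a2 * a4) (u * a3 * a4) (- (u * p)) 0) (vec5 0 0 0 0 q));
  last by rewrite vec5_eq0 !negb_and q0 !orbT.
all: tri5_by ltac:(ring: uE rE a3E a4E).
Qed.

(** The isotropic vector a = (a2, a3, a4) forms a hyperbolic pair with w = a2^-2 (a2, -a3, -a4): w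
    is isotropic and the form takes the value 2 on (a, w). Then (a + w) / 2 and -i (a - w) / 2 are
    orthonormal, and the first plus i times the second is a. A multiple of (0, a4, -a3) completes
    the frame. *)
Lemma tri5_131_isotropic (i : F) a2 a3 a4 a5 :
    2%:R != 0 :> F -> i ^+ 2 = -1 -> a2 != 0 ->
    a2 ^+ 2 + a3 ^+ 2 + a4 ^+ 2 = 0 ->
  isomorphic (T a2 a3 a4 a5) (T 1 i 0 0).
Proof.
move=> two0 iE a20 q0.
have a4E : a4 ^+ 2 = - a2 ^+ 2 - a3 ^+ 2.
  by apply/eqP; rewrite -subr_eq0 -q0; apply/eqP; ring.
pose h : F := 2%:R^-1; pose b := a2^-1.
apply: (isomorphic_tri5 _ _ _ _ (vec5 1 0 0 0 0)
  (vec5 0 (h * (a2 + b)) (h * (a3 - a3 * b ^+ 2)) (h * (a4 - a4 * b ^+ 2)) a5)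
  (vec5 0 (- i * h * (a2 - b)) (- i * h * (a3 + a3 * b ^+ 2))
     (- i * h * (a4 + a4 * b ^+ 2)) 0)
  (vec5 0 0 (- i * b * a4) (i * b * a3) 0) (vec5 0 0 0 0 1)).
all: tri5_by ltac:(rewrite /h /b; field: iE a4E; by rewrite ?a20 ?two0).
Qed.
End Type131.
End NormalForms.

(** * Type [1,1,3]: triples of scalars up to permutation and affine maps *)

Section Type113.
Variable F : closedFieldType.
Implicit Types (A : nalgType F) (a b c t x : F).

Definition tri113 b1 b2 b3 : nalgType F := tri5 0 0 1 b1 0 1 b2 1 b3 1.

Lemma tri5_113_normalize a1 b1 a2 b2 a3 b3 c :
    a1 != 0 -> a2 != 0 -> a3 != 0 -> c != 0 ->
  exists d1 d2 d3,
    isomorphic (tri5 0 0 a1 b1 0 a2 b2 a3 b3 c) (tri113 d1 d2 d3).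
Proof.
move=> /rsqrt_exists[r1 _ r1E] /rsqrt_exists[r2 _ r2E].
move=> /rsqrt_exists[r3 _ r3E] c0.
exists (r1 ^+ 2 * b1 / c), (r2 ^+ 2 * b2 / c), (r3 ^+ 2 * b3 / c).
apply: (isomorphic_tri5 _ _ _ _ (vec5 r1 0 0 0 0) (vec5 0 r2 0 0 0)
  (vec5 0 0 r3 0 0) (vec5 0 0 0 1 0) (vec5 0 0 0 0 c));
  last by rewrite vec5_eq0 !negb_and c0 !orbT.
all: tri5_by ltac:(field: r1E r2E r3E; by []).
Qed.

(** Adding a multiple of the annihilating e_5 to e_4 translates all parameters at once. Scaling the
    top layer by a square root of x^-1 scales e_4 by x^-1 and e_5 by x^-2, which multiplies the
    parameters by x. *)
Lemma tri113_affine t x b1 b2 b3 : x != 0 ->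
  isomorphic (tri113 b1 b2 b3) (tri113 (t + x * b1) (t + x * b2) (t + x * b3)).
Proof.
move=> x0; have [r _ rE] := rsqrt_exists x0.
apply: (isomorphic_tri5 _ _ _ _ (vec5 r 0 0 0 0) (vec5 0 r 0 0 0)
  (vec5 0 0 r 0 0) (vec5 0 0 0 x^-1 (- (x ^- 2 * t))) (vec5 0 0 0 0 (x ^- 2)));
  last by rewrite vec5_eq0 !negb_and invr_eq0 expf_neq0 // !orbT.
all: tri5_by ltac:(field: rE; by rewrite ?x0).
Qed.

Lemma tri113_swap12 b1 b2 b3 : isomorphic (tri113 b1 b2 b3) (tri113 b2 b1 b3).
Proof.
apply: (isomorphic_tri5 _ _ _ _ (vec5 0 1 0 0 0) (vec5 1 0 0 0 0)
  (vec5 0 0 1 0 0) (vec5 0 0 0 1 0) (vec5 0 0 0 0 1)).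
all: tri5_by ltac:(ring).
Qed.

Lemma tri113_swap23 b1 b2 b3 : isomorphic (tri113 b1 b2 b3) (tri113 b1 b3 b2).
Proof.
apply: (isomorphic_tri5 _ _ _ _ (vec5 1 0 0 0 0) (vec5 0 0 1 0 0)
  (vec5 0 1 0 0 0) (vec5 0 0 0 1 0) (vec5 0 0 0 0 1)).
all: tri5_by ltac:(ring).
Qed.

(** The affine map that takes b2 to 0 and b3 to 1. *)
Lemma tri113_ratio b1 b2 b3 : b2 != b3 ->
  isomorphic (tri113 b1 b2 b3) (tri113 ((b1 - b2) / (b3 - b2)) 0 1).
Proof.
move=> b23; have d0 : b3 - b2 != 0 by rewrite subr_eq0 eq_sym.
have := @tri113_affine (- b2 / (b3 - b2)) (b3 - b2)^-1 b1 b2 b3.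
rewrite invr_eq0 => /(_ d0); congr (isomorphic _ (tri113 _ _ _)); by field.
Qed.

Lemma tri113_classify b1 b2 b3 :
  [\/ isomorphic (tri113 b1 b2 b3) (tri113 0 0 0),
      isomorphic (tri113 b1 b2 b3) (tri113 0 0 1)
    | exists a, [/\ a != 0, a != 1 & isomorphic (tri113 b1 b2 b3) (tri113 a 0 1)]].
Proof.
have [<-|b12] := eqVneq b1 b2.
  have [<-|b13] := eqVneq b1 b3.
    have := tri113_affine (- b1) b1 b1 b1 (oner_neq0 F).
    by rewrite mul1r addNr; constructor 1.
  by have := tri113_ratio b1 b13; rewrite subrr mul0r; constructor 2.
have [<-|b23] := eqVneq b2 b3.
  constructor 2; apply: isomorphic_trans (tri113_swap12 _ _ _) _.
  apply: isomorphic_trans (tri113_swap23 _ _ _) _.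
  have := tri113_ratio b2 (_ : b2 != b1); rewrite subrr mul0r eq_sym; exact.
have [<-|b13] := eqVneq b1 b3.
  constructor 2; apply: isomorphic_trans (tri113_swap23 _ _ _) _.
  by have := tri113_ratio b1 b12; rewrite subrr mul0r.
constructor 3; exists ((b1 - b2) / (b3 - b2)); split; last exact: tri113_ratio.
  by rewrite mulf_neq0 ?invr_eq0 ?subr_eq0 // eq_sym.
have d0 : b3 - b2 != 0 by rewrite subr_eq0 eq_sym.
apply: contra_neq b13 => /(congr1 ( *%R^~ (b3 - b2))).
by rewrite mulfVK // mul1r => /addIr.
Qed.

(** The six values are the ratios produced by [tri113_ratio] from the six orderings of a, 0, 1: the
    orbit of a cross-ratio whose fourth point is at infinity. *)
Lemma tri113_param_iso a a' : a != 0 -> a != 1 ->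
  a' \in [:: a; a^-1; 1 - a; 1 - a^-1; (1 - a)^-1; (1 - a^-1)^-1] ->
  isomorphic (tri113 a 0 1) (tri113 a' 0 1).
Proof.
move=> a0 a1; have a1' : 1 - a != 0 by rewrite subr_eq0 eq_sym.
have a1'' : a - 1 != 0 by rewrite subr_eq0.
(* The comments give the order of the parameters to which tri113_ratio applies. *)
have s12 := tri113_swap12; have s23 := tri113_swap23.
rewrite !inE => /or4P[/eqP->|/eqP->|/eqP->|/or3P[] /eqP->].
- by have := tri113_affine 0 a 0 1 (oner_neq0 F); rewrite !mul1r !add0r.
(* 1, 0, a *)
- apply: isomorphic_trans (s12 _ _ _) _; apply: isomorphic_trans (s23 _ _ _) _; apply: isomorphic_trans (s12 _ _ _) _.
  have := @tri113_ratio 1 0 a; rewrite eq_sym => /(_ a0).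
  by rewrite !subr0 div1r.
(* a, 1, 0 *)
- apply: isomorphic_trans (s23 _ _ _) _.
  have := @tri113_ratio a 1 0; rewrite oner_eq0 => /(_ isT).
  congr (isomorphic _ (tri113 _ _ _)); field; by rewrite ?oppr_eq0 ?oner_eq0.
(* 1, a, 0 *)
- apply: isomorphic_trans (s23 _ _ _) _; apply: isomorphic_trans (s12 _ _ _) _.
  have := tri113_ratio 1 a0.
  congr (isomorphic _ (tri113 _ _ _)); field; by rewrite ?oppr_eq0 ?a0.
(* 0, 1, a *)
- apply: isomorphic_trans (s12 _ _ _) _; apply: isomorphic_trans (s23 _ _ _) _.
  have := @tri113_ratio 0 1 a; rewrite eq_sym => /(_ a1).
  congr (isomorphic _ (tri113 _ _ _)); field; by rewrite ?a1' ?a1''.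
(* 0, a, 1 *)
- apply: isomorphic_trans (s12 _ _ _) _.
  have := tri113_ratio 0 a1.
  congr (isomorphic _ (tri113 _ _ _)); field; by rewrite ?a1' ?a1'' ?a0.
Qed.

End Type113.

(** * Type [1,1,1,2]: pairs of weighted parameters *)

Section Type1112.
Variable F : closedFieldType.
Implicit Types (A : nalgType F) (a b c t x : F).

Definition tri1112 b1 c1 b2 c2 : nalgType F := tri5 0 1 b1 c1 1 b2 c2 1 0 1.

Lemma tri5_1112_normalize a1 b1 c1 a2 b2 c2 a3 b3 c :
    a1 != 0 -> a2 != 0 -> a3 != 0 -> c != 0 ->
  exists p1 q1 p2 q2,
    isomorphic (tri5 0 a1 b1 c1 a2 b2 c2 a3 b3 c) (tri1112 p1 q1 p2 q2).
Proof.
move=> /rsqrt_exists[r1 _ r1E] /rsqrt_exists[r2 _ r2E] a30 c0.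
(* The new e_4 and e_5 are the iterated squares of e_3, namely a3 e_4 + b3 e_5 and a3^2 c e_5. The
   functions p and q give the coordinates of a rescaled top square along these two vectors. *)
pose p r b := r ^+ 2 * b / a3 : F.
pose q r b d := (r ^+ 2 * d - p r b * b3) / (a3 ^+ 2 * c).
exists (p r1 b1), (q r1 b1 c1), (p r2 b2), (q r2 b2 c2); rewrite /q /p.
apply: (isomorphic_tri5 _ _ _ _ (vec5 r1 0 0 0 0) (vec5 0 r2 0 0 0)
  (vec5 0 0 1 0 0) (vec5 0 0 0 a3 b3) (vec5 0 0 0 0 (a3 ^+ 2 * c)));
  last by rewrite vec5_eq0 !negb_and mulf_neq0 ?expf_neq0 // !orbT.
all: tri5_by ltac:(field: r1E r2E; by rewrite ?a30 ?c0).
Qed.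

(** The vectors e_3, e_4, e_5 are scaled by x^-1, x^-2, x^-4, each weight being the square of the
    previous one, whence the weights 1 and 3 of b and c. Moving e_3 along e_5 translates the c_k. *)
Lemma tri1112_scale t x b1 c1 b2 c2 : x != 0 ->
  isomorphic (tri1112 b1 c1 b2 c2)
    (tri1112 (x * b1) (t + x ^+ 3 * c1) (x * b2) (t + x ^+ 3 * c2)).
Proof.
move=> x0; have [r _ rE] := rsqrt_exists x0.
apply: (isomorphic_tri5 _ _ _ _ (vec5 r 0 0 0 0) (vec5 0 r 0 0 0)
  (vec5 0 0 x^-1 0 (- (x ^- 4 * t))) (vec5 0 0 0 (x ^- 2) 0)
  (vec5 0 0 0 0 (x ^- 4)));
  last by rewrite vec5_eq0 !negb_and invr_eq0 expf_neq0 // !orbT.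
all: tri5_by ltac:(field: rE; by rewrite ?x0).
Qed.

Lemma tri1112_swap b1 c1 b2 c2 :
  isomorphic (tri1112 b1 c1 b2 c2) (tri1112 b2 c2 b1 c1).
Proof.
apply: (isomorphic_tri5 _ _ _ _ (vec5 0 1 0 0 0) (vec5 1 0 0 0 0)
  (vec5 0 0 1 0 0) (vec5 0 0 0 1 0) (vec5 0 0 0 0 1)).
all: tri5_by ltac:(ring).
Qed.

Lemma tri1112_classify b1 c1 b2 c2 : let A := tri1112 b1 c1 b2 c2 in
  [\/ isomorphic A (tri1112 0 0 0 0), isomorphic A (tri1112 0 1 0 0),
      exists c, isomorphic A (tri1112 1 c 0 0)
    | exists b c, b != 0 /\ isomorphic A (tri1112 1 c b 0)].
Proof.
(* After a swap, b1 vanishes only if both b1 and b2 do. If b1 != 0, it is scaled to 1 and a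
   translation kills c2. If both vanish, only the difference c1 - c2 matters, and a cube root scales
   it to 1 unless it is 0. *)
rewrite /=; wlog b10 : b1 c1 b2 c2 / b2 != 0 -> b1 != 0.
  have [->|b10] := eqVneq b1 0 => /=; last by apply.
  move=> /(_ b2 c2 0 c1); rewrite eqxx => /(_ (fun h => False_ind _ (notF h))) /=.
  have sw C := isomorphic_trans (tri1112_swap 0 c1 b2 c2) (C := C).
  case=> [/sw|/sw|[c /sw]|[b [c [? /sw]]]] ?; first [by constructor 1
    | by constructor 2 | by constructor 3; exists c
    | by constructor 4; exists b, c].
have [b1E|b1n] := eqVneq b1 0.
  have b2E : b2 = 0 by apply/eqP; apply: contraT => /b10; rewrite b1E eqxx.
  rewrite b1E b2E {b10 b1E b2E}.
  have [->|c12] := eqVneq c1 c2.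
    constructor 1; have := tri1112_scale (- c2) 0 c2 0 c2 (oner_neq0 F).
    by rewrite expr1n !mul1r addNr.
  have [x xE] := cbrt_exists (c1 - c2)^-1.
  have d0 : c1 - c2 != 0 by rewrite subr_eq0.
  have x0 : x != 0.
    by apply: contraTneq d0 => x0; rewrite negbK -invr_eq0 -xE x0 expr0n.
  constructor 2; have := tri1112_scale (- (x ^+ 3 * c2)) 0 c1 0 c2 x0.
  by rewrite !mulr0 addNr xE; congr (isomorphic _ (tri1112 _ _ _ _)); field.
have := @tri1112_scale (- (b1^-1 ^+ 3 * c2)) b1^-1 b1 c1 b2 c2.
rewrite invr_eq0 => /(_ b1n); rewrite mulVf // addNr => isoA.
have [b2E|b2n] := eqVneq b2 0.
  by constructor 3; eexists; move: isoA; rewrite b2E mulr0; apply.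
constructor 4; do 2!eexists; split; last exact: isoA.
by rewrite mulf_neq0 ?invr_eq0.
Qed.

Lemma tri1112_param_iso b c : b != 0 ->
  isomorphic (tri1112 1 c b 0) (tri1112 1 (- (b ^- 3 * c)) b^-1 0).
Proof.
move=> b0; apply: isomorphic_trans (tri1112_swap _ _ _ _) _.
have := @tri1112_scale (- (b ^- 3 * c)) b^-1 b 0 1 c; rewrite invr_eq0.
move=> /(_ b0); congr (isomorphic _ (tri1112 _ _ _ _)); by field.
Qed.

End Type1112.

(** * Invariants *)

Section Invariants.
Variable F : closedFieldType.
Implicit Types (a b c t x : F).

(** For a square matrix, M^T M is the same scalar x. Multiplying M D M^T = G on the right by M gives
    x M D = G M, whose entry (j, l) reads x M_jl d_l = g_j M_jl. No row or column of M vanishes,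
    since the diagonals of M M^T and M^T M consist of x. *)
Lemma orthogonal_pencil n (M : 'M[F]_n) x : x != 0 -> M *m M^T = x%:M ->
  [/\ forall j, exists l, M j l != 0, forall l, exists j, M j l != 0
    & forall d g : 'I_n -> F,
        (forall j k, \sum_l M j l * M k l * d l = if j == k then g j else 0) ->
        forall j l, M j l != 0 -> g j = x * d l].
Proof.
move=> x0 MMt.
have MtM : M^T *m M = x%:M.
  have : M *m (x^-1 *: M^T) = 1%:M.
    by rewrite -scalemxAr MMt scale_scalar_mx mulVf.
  move/mulmx1C; rewrite -scalemxAl => /(congr1 ( *:%R x)).
  by rewrite scalerA divff // scale1r scale_scalar_mx mulr1.
have ex (N : 'M[F]_n) j : N *m N^T = x%:M -> exists l, N j l != 0.
  move/matrixP/(_ j j); rewrite !mxE eqxx mulr1n => NN.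
  apply/existsP; apply: contraNT x0 => /existsPn N0; rewrite -NN big1 // => l _.
  by have := N0 l; rewrite negbK => /eqP->; rewrite mul0r.
split=> [j|l|d g dg j l Mjl]; first exact: ex.
  have [|j] := ex M^T l; first by rewrite trmxK.
  by rewrite mxE; exists j.
have : M *m diag_mx (\row_l d l) *m M^T *m M = diag_mx (\row_l g l) *m M.
  congr (_ *m _); apply/matrixP=> p q; rewrite !mxE.
  under eq_bigr do rewrite mul_mx_diag !mxE mulrAC.
  by rewrite dg; case: eqP => // ->.
rewrite -mulmxA MtM mul_mx_diag mul_diag_mx => /matrixP/(_ j l).
rewrite mul_mx_scalar !mxE => h; apply: (mulIf Mjl); rewrite -h; ring.
Qed.

(** The coordinates of v_0, v_1, v_2 on the top layer form M. Their products read on e_4 give M M^T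
    = y, and read on e_5 give M diag(b) M^T = diag(z + d_j y^2), where y and z are the coordinates
    of v_3. The conclusion compares parameters as sets, without multiplicities. *)
Lemma tri113_invariant b1 b2 b3 d1 d2 d3 :
  isomorphic (tri113 b1 b2 b3) (tri113 d1 d2 d3) ->
  exists t x, x != 0 /\
    [seq t + x * b | b <- [:: b1; b2; b3]] =i [:: d1; d2; d3].
Proof.
have dim5 : \dim {:tri113 b1 b2 b3} = 5%N by rewrite dimvf /dim /= mul1n.
move=> /tri5_isomorphic[]; rewrite ?oner_eq0 ?orbT //.
move=> v v4n vM; pose m j k : F := (v j : 'rV_5) 0 (inord k).
have mE j : v j = vec5 (m j 0) (m j 1) (m j 2) (m j 3) (m j 4) by apply: vec5_eta.
have co j k : amul (v j) (v k) = vec5 0 0 0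
      (m j 0 * m k 0 + m j 1 * m k 1 + m j 2 * m k 2)
      (m j 0 * m k 0 * b1 + m j 1 * m k 1 * b2 + m j 2 * m k 2 * b3 + m j 3 * m k 3).
  by rewrite {1}mE (mE k) tri5_mul; congr vec5; ring.
have := vM 3%N 3%N isT isT; rewrite co /= scale1r => v4E.
(* The vector v_3 = v_0^2 - d1 v_4 is a combination of squares, as v_4 = v_3^2, so it has no
   component on the top layer. *)
have := vM 0%N 0%N isT isT; rewrite co /= !scale0r !add0r scale1r (mE 3%N) -v4E.
rewrite vec5Z vec5D => /vec5_inj[/esym + /esym + /esym + _ _]; rewrite !mulr0 !addr0.
move=> m30 m31 m32.
pose y := m 3%N 3%N; pose z := m 3%N 4%N.
have v3E : v 3%N = vec5 0 0 0 y z by rewrite mE m30 m31 m32.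
have {}v4E : v 4%N = vec5 0 0 0 0 (y ^+ 2).
  by rewrite -v4E m30 m31 m32; congr vec5; rewrite /y; ring.
have y0 : y != 0.
  by apply: contraNneq v4n => y0; rewrite v4E y0 vec5_0 expr0n.
have mj3 j : (j < 3)%N -> m j 3 = 0.
  move=> j3; have := vM j 3%N (@leq_trans 3 _ 5 j3 isT) isT; rewrite co m30 m31 m32.
  rewrite (ltn_eqF j3) vec5_0 => /vec5_inj[_ _ _ _ /eqP].
  by rewrite !mulr0 !mul0r !add0r mulf_eq0 (negbTE y0) orbF => /eqP.
pose M : 'M_3 := \matrix_(j < 3, l < 3) m j l.
pose d j := [:: d1; d2; d3]`_j; pose b j := [:: b1; b2; b3]`_j.
have prod j k : (j < 3)%N -> (k < 3)%N ->
    m j 0 * m k 0 + m j 1 * m k 1 + m j 2 * m k 2 = y *+ (j == k) /\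
    m j 0 * m k 0 * b1 + m j 1 * m k 1 * b2 + m j 2 * m k 2 * b3 =
      if j == k then z + d j * y ^+ 2 else 0.
  move=> j3 k3; have := vM j k (@leq_trans 3 _ 5 j3 isT) (@leq_trans 3 _ 5 k3 isT).
  rewrite co mj3 // mul0r addr0; case: eqP => [<-|_].
    rewrite (_ : nth _ _ _ = vec5 0 0 0 y (z + d j * y ^+ 2)).
      by case/vec5_inj.
    by case: j j3 => [|[|[|//]]] _ /=; rewrite ?scale0r ?add0r !scale1r v3E v4E
      vec5Z vec5D; congr vec5; rewrite /d /=; ring.
  by rewrite vec5_0 => /vec5_inj[].
have [|row col pen] := orthogonal_pencil (M := M) y0.
  apply/matrixP=> j k; rewrite !mxE !big_ord_recr big_ord0 /= !mxE add0r.
  by have [-> _] := prod j k (ltn_ord j) (ltn_ord k).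
have rel (j l : 'I_3) : M j l != 0 -> d j = - z / y ^+ 2 + y^-1 * b l.
  move=> Mjl; have dE : z + d j * y ^+ 2 = y * b l.
    apply: (pen (fun l => b l) (fun j => z + d j * y ^+ 2)) Mjl => p q.
    rewrite !big_ord_recr big_ord0 /= !mxE add0r.
    by have [_ ->] := prod p q (ltn_ord p) (ltn_ord q).
  apply: (mulIf (expf_neq0 2 y0)); rewrite -[LHS](addKr z) dE; by field.
have nthP3 (e : nat -> F) c : c \in [:: e 0; e 1; e 2] -> exists j : 'I_3, c = e j.
  rewrite !inE => /or3P[] /eqP->.
  - by exists (@Ordinal 3 0 isT).
  - by exists (@Ordinal 3 1 isT).
  - by exists (@Ordinal 3 2 isT).
have memP3 (e : nat -> F) (j : 'I_3) : e j \in [:: e 0; e 1; e 2].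
  by case: j => [[|[|[|//]]] ?]; rewrite !inE eqxx ?orbT.
exists (- z / y ^+ 2), y^-1; split; first by rewrite invr_eq0.
move=> c; apply/idP/idP.
  move/(nthP3 (fun j => - z / y ^+ 2 + y^-1 * b j)) => [l ->].
  by have [j /rel<-] := col l; apply: (memP3 d).
move/(nthP3 d)=> [j ->]; have [l /rel->] := row j.
exact: (memP3 (fun j => - z / y ^+ 2 + y^-1 * b j)).
Qed.

(** The same matrix M intertwines the diagonal matrices of both the b_k and the c_k. A single
    nonzero entry of M therefore matches the two components of a parameter pair simultaneously, and
    sets of pairs are compared. *)
Lemma tri1112_invariant b1 c1 b2 c2 d1 e1 d2 e2 :
  isomorphic (tri1112 b1 c1 b2 c2) (tri1112 d1 e1 d2 e2) ->
  exists t x, x != 0 /\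
    [:: (x * b1, t + x ^+ 3 * c1); (x * b2, t + x ^+ 3 * c2)]
      =i [:: (d1, e1); (d2, e2)].
Proof.
have dim5 : \dim {:tri1112 b1 c1 b2 c2} = 5%N by rewrite dimvf /dim /= mul1n.
move=> /tri5_isomorphic[]; rewrite ?oner_eq0 ?orbT //.
move=> v v4n vM; pose m j k : F := (v j : 'rV_5) 0 (inord k).
have mE j : v j = vec5 (m j 0) (m j 1) (m j 2) (m j 3) (m j 4) by apply: vec5_eta.
have co j k : amul (v j) (v k) = vec5 0 0
      (m j 0 * m k 0 + m j 1 * m k 1)
      (m j 0 * m k 0 * b1 + m j 1 * m k 1 * b2 + m j 2 * m k 2)
      (m j 0 * m k 0 * c1 + m j 1 * m k 1 * c2 + m j 3 * m k 3).
  by rewrite {1}mE (mE k) tri5_mul; congr vec5; ring.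
have := vM 2%N 2%N isT isT; rewrite co /= scale1r scale0r addr0 => v3E.
have := vM 3%N 3%N isT isT; rewrite co /= scale1r => v4E.
have := vM 0%N 0%N isT isT; rewrite co /= !scale0r !add0r scale1r (mE 2%N) -v3E -v4E.
rewrite !vec5Z !vec5D => /vec5_inj[/esym + /esym + _ _ _]; rewrite !mulr0 !addr0.
move=> m20 m21.
pose x := m 2%N 2%N; pose y := m 2%N 3%N; pose z := m 2%N 4%N.
have v2E : v 2%N = vec5 0 0 x y z by rewrite mE m20 m21.
have {}v3E : v 3%N = vec5 0 0 0 (x ^+ 2) (y ^+ 2).
  by rewrite -v3E m20 m21; congr vec5; rewrite /x /y; ring.
have [m30 m31 m32 m33 m34] := vec5_inj (etrans (esym (mE 3%N)) v3E).
have {}v4E : v 4%N = vec5 0 0 0 0 (x ^+ 4).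
  by rewrite -v4E m30 m31 m32 m33; congr vec5; ring.
have x0 : x != 0.
  by apply: contraNneq v4n => x0; rewrite v4E x0 vec5_0 expr0n.
(* A component of v_2 along e_4 would make v_2 v_3 nonzero, because v_3 = v_2^2 has the nonzero
   coordinate x^2 on e_4. *)
have y0 : y = 0.
  have := vM 2%N 3%N isT isT; rewrite co m30 m31 m32 m33 vec5_0.
  move=> /vec5_inj[_ _ _ _ /eqP]; rewrite !mulr0 !mul0r !add0r.
  by rewrite mulf_eq0 (negbTE (expf_neq0 2 x0)) orbF => /eqP.
have mj3 j : (j < 2)%N -> m j 3 = 0.
  move=> j2; have := vM j 3%N (@leq_trans 2 _ 5 j2 isT) isT.
  rewrite co m30 m31 m33 (ltn_eqF (@leq_trans 2 _ 3 j2 isT)) vec5_0.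
  move=> /vec5_inj[_ _ _ _ /eqP]; rewrite !mulr0 !mul0r !add0r.
  by rewrite mulf_eq0 (negbTE (expf_neq0 2 x0)) orbF => /eqP.
have mj2 j : (j < 2)%N -> m j 2 = 0.
  move=> j2; have := vM j 2%N (@leq_trans 2 _ 5 j2 isT) isT.
  rewrite co m20 m21 (ltn_eqF j2) vec5_0.
  move=> /vec5_inj[_ _ _ /eqP + _]; rewrite !mulr0 !mul0r !add0r.
  by rewrite mulf_eq0 (negbTE x0) orbF => /eqP.
pose M : 'M_2 := \matrix_(j < 2, l < 2) m j l.
pose d j := [:: d1; d2]`_j; pose b j := [:: b1; b2]`_j.
pose e j := [:: e1; e2]`_j; pose c j := [:: c1; c2]`_j.
have prod j k : (j < 2)%N -> (k < 2)%N ->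
    [/\ m j 0 * m k 0 + m j 1 * m k 1 = x *+ (j == k),
        m j 0 * m k 0 * b1 + m j 1 * m k 1 * b2 =
          if j == k then d j * x ^+ 2 else 0
      & m j 0 * m k 0 * c1 + m j 1 * m k 1 * c2 =
          if j == k then z + e j * x ^+ 4 else 0].
  move=> j2 k2.
  have := vM j k (@leq_trans 2 _ 5 j2 isT) (@leq_trans 2 _ 5 k2 isT).
  rewrite co mj3 // mj2 // !mul0r !addr0; case: eqP => [<-|_].
    rewrite (_ : nth _ _ _ = vec5 0 0 x (d j * x ^+ 2) (z + e j * x ^+ 4)).
      by case/vec5_inj.
    by case: j j2 => [|[|//]] _ /=; rewrite ?scale0r ?add0r !scale1r v2E v3E v4E
      !vec5Z !vec5D y0; congr vec5; rewrite /d /e /=; ring.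
  by rewrite vec5_0 => /vec5_inj[].
have [|row col pen] := orthogonal_pencil (M := M) x0.
  apply/matrixP=> j k; rewrite !mxE !big_ord_recr big_ord0 /= !mxE add0r.
  by have [-> _ _] := prod j k (ltn_ord j) (ltn_ord k).
pose im l := (x^-1 * b l, - z / x ^+ 4 + x^-1 ^+ 3 * c l); pose de j := (d j, e j).
have rel (j l : 'I_2) : M j l != 0 -> de j = im l.
  move=> Mjl; have dE : d j * x ^+ 2 = x * b l.
    apply: (pen (fun l => b l) (fun j => d j * x ^+ 2)) Mjl => p q.
    rewrite !big_ord_recr big_ord0 /= !mxE add0r.
    by have [_ -> _] := prod p q (ltn_ord p) (ltn_ord q).
  have eE : z + e j * x ^+ 4 = x * c l.
    apply: (pen (fun l => c l) (fun j => z + e j * x ^+ 4)) Mjl => p q.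
    rewrite !big_ord_recr big_ord0 /= !mxE add0r.
    by have [_ _ ->] := prod p q (ltn_ord p) (ltn_ord q).
  congr (_, _).
    by apply: (mulIf (expf_neq0 2 x0)); rewrite dE; field.
  by apply: (mulIf (expf_neq0 4 x0)); rewrite -[LHS](addKr z) eE; field.
have nthP2 (f : nat -> F * F) p : p \in [:: f 0; f 1] -> exists j : 'I_2, p = f j.
  rewrite !inE => /orP[] /eqP->.
  - by exists (@Ordinal 2 0 isT).
  - by exists (@Ordinal 2 1 isT).
have memP2 (f : nat -> F * F) (j : 'I_2) : f j \in [:: f 0; f 1].
  by case: j => [[|[|//]] ?]; rewrite !inE eqxx ?orbT.
exists (- z / x ^+ 4), x^-1; split; first by rewrite invr_eq0.
move=> p; apply/idP/idP.
  by move/(nthP2 im) => [l ->]; have [j /rel<-] := col l; apply: (memP2 de).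
by move/(nthP2 de) => [j ->]; have [l /rel->] := row j; apply: (memP2 im).
Qed.

End Invariants.

(** * The families of the classification and their separation *)

Section Families.
Variable F : closedFieldType.
Implicit Types i a b c p q t x : F.

Ltac family_eq := rewrite ?std_basis5E ?vec5Z ?vec5D; congr evol5; congr vec5;
  rewrite /= ?mulr0n ?mulr1n; ring.

Lemma E14E : E14 = tri5 0 0 0 1 0 0 1 0 1 1 :> nalgType F.
Proof. by rewrite /E14 /tri5; family_eq. Qed.

Lemma E131_1E : E131_1 = tri5 1 0 0 0 0 0 1 0 1 1 :> nalgType F.
Proof. by rewrite /E131_1 /tri5; family_eq. Qed.

Lemma E131_2E i : E131_2 i = tri5 1 i 0 0 0 0 1 0 1 1.
Proof. by rewrite /E131_2 /tri5; family_eq. Qed.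

Lemma E113_1E : E113_1 = tri113 0 0 0 :> nalgType F.
Proof. by rewrite /E113_1 /tri113 /tri5; family_eq. Qed.

Lemma E113_2E : E113_2 = tri113 0 0 1 :> nalgType F.
Proof. by rewrite /E113_2 /tri113 /tri5; family_eq. Qed.

Lemma E113_3E a : E113_3 a = tri113 a 0 1.
Proof. by rewrite /E113_3 /tri113 /tri5; family_eq. Qed.

Lemma E1112_1E : E1112_1 = tri1112 0 0 0 0 :> nalgType F.
Proof. by rewrite /E1112_1 /tri1112 /tri5; family_eq. Qed.

Lemma E1112_2E : E1112_2 = tri1112 0 1 0 0 :> nalgType F.
Proof. by rewrite /E1112_2 /tri1112 /tri5; family_eq. Qed.

Lemma E1112_3E c : E1112_3 c = tri1112 1 c 0 0.
Proof. by rewrite /E1112_3 /tri1112 /tri5; family_eq. Qed.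

Lemma E1112_4E b c : E1112_4 b c = tri1112 1 c b 0.
Proof. by rewrite /E1112_4 /tri1112 /tri5; family_eq. Qed.

(* The map [x |-> x^2 x^2] vanishes on the second algebra only. *)
Lemma E131_not_iso i : i ^+ 2 = -1 -> ~ isomorphic E131_1 (E131_2 i).
Proof.
rewrite E131_1E E131_2E => iE [f [kf _ fM]].
have sq0 (x : tri5 1 i 0 0 0 0 1 0 1 1) : let y := amul x x in
    amul y y = 0.
  by rewrite /= (vec5_eta x) !tri5_mul vec5_0; congr vec5; ring: iE.
pose u : tri5 1 0 0 0 0 0 1 0 1 1 := @vec5 F 1 0 0 0 0.
have := sq0 (f u); rewrite /= -!fM => /eqP; rewrite -memv_ker kf memv0.
rewrite !tri5_mul vec5_eq0 !(mulr1, mul1r, mulr0, mul0r, addr0, add0r).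
by rewrite oner_eq0 !andbF.
Qed.

(** Transpositions of e_2, e_3, e_4 bring a nonzero coordinate to the front in the isotropic case,
    and a partial sum of two squares that is nonzero in the anisotropic case. *)
Lemma tri5_131_classify i a2 a3 a4 a5 :
    2%:R != 0 :> F -> i ^+ 2 = -1 -> [|| a2 != 0, a3 != 0 | a4 != 0] ->
  let A := tri5 a2 a3 a4 a5 0 0 1 0 1 1 in
  isomorphic A E131_1 \/ isomorphic A (E131_2 i).
Proof.
rewrite E131_1E E131_2E /= => two0 iE.
have sw23 b2 b3 b4 b5 := @tri5_131_swap23 F b2 b3 b4 b5.
have sw34 b2 b3 b4 b5 := @tri5_131_swap34 F b2 b3 b4 b5.
have [q0|q0] := eqVneq (a2 ^+ 2 + a3 ^+ 2 + a4 ^+ 2) 0.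
  have iso b2 b3 b4 b5 := @tri5_131_isotropic F i b2 b3 b4 b5 two0 iE.
  case/or3P=> an; right.
  - exact: iso.
  - apply: isomorphic_trans (sw23 _ _ _ _ _) _; first by rewrite an !orbT.
    by apply: iso; rewrite // -q0; ring.
  - apply: isomorphic_trans (sw34 _ _ _ _ _) _; first by rewrite an !orbT.
    apply: isomorphic_trans (sw23 _ _ _ _ _) _; first by rewrite an !orbT.
    by apply: iso; rewrite // -q0; ring.
have iso b2 b3 b4 b5 := @tri5_131_anisotropic F b2 b3 b4 b5.
move=> /or3P a_neq0; left.
have a0 : [|| a2 != 0, a3 != 0, a4 != 0 | a5 != 0].
  by case: a_neq0 => ->; rewrite ?orbT.
have [p0|] := eqVneq (a2 ^+ 2 + a3 ^+ 2) 0; last by move=> p0; apply: iso.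
have [p1|p1] := eqVneq (a2 ^+ 2 + a4 ^+ 2) 0; last first.
  apply: isomorphic_trans (sw34 _ _ _ _ a0) _; apply: iso => //.
  by rewrite addrAC.
apply: isomorphic_trans (sw23 _ _ _ _ a0) _.
apply: isomorphic_trans (sw34 _ _ _ _ _) _.
  by case/or4P: a0 => ->; rewrite ?orbT.
apply: iso; last by rewrite addrC addrA.
(* The three sums of two squares add up to twice the norm, so in characteristic not two they cannot
   all vanish. *)
apply: contraNneq q0 => p2; apply/eqP/(mulfI two0); rewrite mulr0.
transitivity ((a2 ^+ 2 + a3 ^+ 2) + (a2 ^+ 2 + a4 ^+ 2) + (a3 ^+ 2 + a4 ^+ 2)).
  by ring.
by rewrite p0 p1 p2 !addr0.
Qed.

(** Let p, q, r be preimages of 0, 1, a' among a, 0, 1. They are distinct and a' = (r - p) / (q -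
    p), so the six orderings give the six values. *)
Lemma affine_image3 a a' t x : a != 0 -> a != 1 -> a' != 0 -> a' != 1 ->
    [seq t + x * b | b <- [:: a; 0; 1]] =i [:: a'; 0; 1] ->
  a' \in [:: a; a^-1; 1 - a; 1 - a^-1; (1 - a)^-1; (1 - a^-1)^-1].
Proof.
move=> a0 a1 a'0 a'1 im.
have a1' : 1 - a != 0 by rewrite subr_eq0 eq_sym.
have a1'' : a - 1 != 0 by rewrite subr_eq0.
have im_ex c : c \in [:: a'; 0; 1] ->
    exists2 b, b \in [:: a; 0; 1] & c = t + x * b.
  by rewrite -im => /mapP.
have [|p pin p0] := im_ex 0; first by rewrite !inE eqxx orbT.
have [|q qin q1] := im_ex 1; first by rewrite !inE eqxx !orbT.
have [|r rin ra] := im_ex a'; first by rewrite inE eqxx.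
have xqp : x * (q - p) = 1.
  by transitivity ((t + x * q) - (t + x * p)); [ring | rewrite -q1 -p0 subr0].
have a'E : a' = x * (r - p).
  by transitivity ((t + x * r) - (t + x * p)); [rewrite -ra -p0 subr0 | ring].
have rp : r != p by apply: contraNneq a'0 => rp; rewrite a'E rp subrr mulr0.
have rq : r != q by apply: contraNneq a'1 => rq; rewrite ra rq -q1.
have qp : q - p != 0.
  by apply: contraNneq (oner_neq0 F) => h; rewrite -xqp h mulr0.
have {}a'E : a' = (r - p) / (q - p).
  by apply: (mulIf qp); rewrite a'E mulfVK // mulrAC xqp mul1r.
rewrite subr_eq0 in qp.
have side := (a0, a1', a1'', oppr_eq0, oner_eq0 F).
rewrite {}a'E !inE.
move: pin qin rin; rewrite !inE.
case/or3P=> /eqP pE /or3P[] /eqP qE /or3P[] /eqP rE;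
  rewrite pE qE rE ?eqxx // in rp rq qp *.
- rewrite [X in X == 1 - a^-1](_ : _ = 1 - a^-1) ?eqxx ?orbT //.
  by field; rewrite !side.
- rewrite [X in X == (1 - a^-1)^-1](_ : _ = (1 - a^-1)^-1) ?eqxx ?orbT //.
  by field; rewrite !side.
- by rewrite !subr0 div1r eqxx orbT.
- by rewrite !subr0 divr1 eqxx.
- rewrite [X in X == (1 - a)^-1](_ : _ = (1 - a)^-1) ?eqxx ?orbT //.
  by field; rewrite !side.
- rewrite [X in X == 1 - a](_ : _ = 1 - a) ?eqxx ?orbT //.
  by field; rewrite !side.
Qed.

Lemma tri113_param_invariant a a' : a != 0 -> a != 1 -> a' != 0 -> a' != 1 ->
  isomorphic (tri113 a 0 1) (tri113 a' 0 1) ->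
  a' \in [:: a; a^-1; 1 - a; 1 - a^-1; (1 - a)^-1; (1 - a^-1)^-1].
Proof.
by move=> a0 a1 a'0 a'1 /tri113_invariant[t [x [_ im]]]; apply: affine_image3 im.
Qed.

Lemma tri113_000_not_iso a : ~ isomorphic (tri113 0 0 0) (tri113 a 0 1).
Proof.
move=> /tri113_invariant[t [x [_ im]]].
have := im 0; have := im 1; rewrite !inE /= !mulr0 !addr0 !eqxx !orbT !orbb.
by move=> /eqP<-; rewrite eq_sym oner_eq0.
Qed.

(** The image of two parameters cannot have three elements. *)
Lemma tri113_001_not_iso a : a != 0 -> a != 1 ->
  ~ isomorphic (tri113 0 0 1) (tri113 a 0 1).
Proof.
move=> a0 a1 /tri113_invariant[t [x [_ im]]].
have := im 0; have := im 1; have := im a; rewrite !inE /= !eqxx !orbT.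
move=> /or3P[] /eqP aE /or3P[] /eqP E1 /or3P[] /eqP E0;
  first [ by case/eqP: a0; rewrite aE -E0 | by case/eqP: a1; rewrite aE -E1
        | by case/eqP: (oner_neq0 F); rewrite [LHS]E1 -E0 ].
Qed.

(** First components are only multiplied by x, so the value 0 is preserved. *)
Lemma tri1112_iso_fst0 c c' p q p' q' :
  isomorphic (tri1112 0 c 0 c') (tri1112 p q p' q') -> p = 0 /\ p' = 0.
Proof.
move=> /tri1112_invariant[t [x [_ im]]].
have := im (p, q); have := im (p', q'); rewrite !inE !xpair_eqE !eqxx /= !orbT !mulr0.
by rewrite -!andb_orr => /andP[/eqP-> _] /andP[/eqP-> _].
Qed.

Lemma tri1112_0000_iso p q p' q' :
  isomorphic (tri1112 0 0 0 0) (tri1112 p q p' q') -> q = q'.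
Proof.
move=> /tri1112_invariant[t [x [_ im]]].
have := im (p, q); have := im (p', q'); rewrite !inE !xpair_eqE !eqxx /= !orbT !orbb.
by move=> /andP[_ /eqP->] /andP[_ /eqP->].
Qed.

Lemma tri1112_1c00_iso c p q p' q' :
  isomorphic (tri1112 1 c 0 0) (tri1112 p q p' q') -> p = 0 \/ p' = 0.
Proof.
move=> /tri1112_invariant[t [x [_ im]]].
have := im (0, t + x ^+ 3 * 0); rewrite !inE !xpair_eqE !mulr0 !eqxx /= orbT.
by move=> /esym/orP[] /andP[/eqP<- _]; [left|right].
Qed.

Lemma tri1112_1c00_inj c c' :
  isomorphic (tri1112 1 c 0 0) (tri1112 1 c' 0 0) -> c = c'.
Proof.
move=> /tri1112_invariant[t [x [_ im]]].
have := im (0, 0); have := im (1, c').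
rewrite !inE !xpair_eqE !eqxx /= !orbT !mulr0 mulr1 oner_eq0 /= orbF !addr0.
move=> /andP[/eqP<- /eqP->]; rewrite [0 == 1]eq_sym oner_eq0 eqxx /= => /eqP<-.
by rewrite expr1n mul1r add0r.
Qed.

(** The pair (1, c') is the image of (1, c), which forces x = 1, or of (b, 0), which forces x =
    b^-1. These give the two alternatives, except where both target pairs are images of the same
    pair. *)
Lemma tri1112_param_invariant b c b' c' :
  isomorphic (tri1112 1 c b 0) (tri1112 1 c' b' 0) ->
  (b', c') = (b, c) \/ (b', c') = (b^-1, - (b ^- 3 * c)).
Proof.
move=> /tri1112_invariant[t [x [x0 im]]].
have := im (1, c'); have := im (b', 0); have := im (x * 1, t + x ^+ 3 * c).
have := im (x * b, t + x ^+ 3 * 0).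
rewrite !inE !xpair_eqE !eqxx /= !orbT !mulr0 mulr1 !addr0.
move=> /esym/orP im2 /esym/orP im1 /orP im3 /orP[] /andP[/eqP xE /eqP tE].
- rewrite -xE expr1n !mul1r in tE im1 im2 im3 *.
  left; case: im3 => /andP[/eqP b'E /eqP t0].
    case: im2 => /andP[/eqP bE /eqP tc].
      have c0 : c = 0 by apply: (addrI t); rewrite addr0 -tE tc.
      by rewrite b'E bE tE -t0 c0.
    by rewrite -bE tE tc add0r.
  by rewrite b'E tE -t0 add0r.
have b0 : b != 0 by apply: contraNneq (oner_neq0 F) => b0; rewrite xE b0 mulr0.
have {}xE : x = b^-1 by apply: (mulIf b0); rewrite -xE mulVf.
case: im3 => /andP[/eqP b'E /eqP t0].
  right; rewrite b'E tE -xE; congr (_, _); apply/eqP.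
  by rewrite -exprVn -xE -addr_eq0 -t0.
(* Here (1, c') and (b', 0) are both the image of (b, 0), so they coincide with (1, 0). The image of
   (1, c) is then (1, 0) too, which gives x = 1, b = 1 and c = 0. *)
left; have {}b'E : b' = 1 by rewrite b'E xE mulVf.
have [x1 c0] : x = 1 /\ x ^+ 3 * c = 0.
  move: im1; rewrite tE -t0 add0r b'E.
  by case=> /andP[/eqP-> /eqP->].
have b1 : b = 1 by rewrite -[b]invrK -xE x1 invr1.
by rewrite b'E b1 tE -t0 -c0 x1 expr1n mul1r.
Qed.

Lemma tri1112_param_isoP b c b' c' : b != 0 ->
  isomorphic (tri1112 1 c b 0) (tri1112 1 c' b' 0) <->
  (b', c') = (b, c) \/ (b', c') = (b^-1, - (b ^- 3 * c)).
Proof.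
move=> b0; split; first exact: tri1112_param_invariant.
case=> -[-> ->]; last exact: tri1112_param_iso.
have := tri1112_scale 0 1 c b 0 (oner_neq0 F).
by rewrite expr1n !mul1r !add0r.
Qed.

End Families.

Theorem theorem6p4 (F : closedFieldType) (charF : 2%N \notin [pchar F])
    (i : F) (sqr_i : i ^+ 2 = -1) :
  (forall E : nalgType F,
     evolution_algebra E -> indecomposable E -> \dim {:E} = 5%N -> nilpotent E ->
     [/\ has_type E [:: 1; 4]%N ->
           isomorphic E E14,
         has_type E [:: 1; 3; 1]%N ->
           (isomorphic E E131_1 \/ isomorphic E (E131_2 i)) /\
           ~ (isomorphic E E131_1 /\ isomorphic E (E131_2 i)),
         has_type E [:: 1; 1; 3]%N ->
           [\/ isomorphic E E113_1, isomorphic E E113_2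
             | exists alpha : F,
                 [/\ alpha != 0, alpha != 1 & isomorphic E (E113_3 alpha)]]
       & has_type E [:: 1; 1; 1; 2]%N ->
           [\/ isomorphic E E1112_1, isomorphic E E1112_2,
               exists gamma : F, isomorphic E (E1112_3 gamma)
             | exists beta gamma : F,
                 beta != 0 /\ isomorphic E (E1112_4 beta gamma)]])
  /\
  [/\ ~ isomorphic (@E113_1 F) E113_2,
      forall alpha : F, alpha != 0 -> alpha != 1 ->
        ~ isomorphic E113_1 (E113_3 alpha),
      forall alpha : F, alpha != 0 -> alpha != 1 ->
        ~ isomorphic E113_2 (E113_3 alpha)
    & forall alpha alpha' : F, alpha != 0 -> alpha != 1 ->
        alpha' != 0 -> alpha' != 1 ->
        isomorphic (E113_3 alpha) (E113_3 alpha') <->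
        alpha' \in [:: alpha; alpha^-1; 1 - alpha; 1 - alpha^-1;
                       (1 - alpha)^-1; (1 - alpha^-1)^-1]]
  /\
  [/\ [/\ ~ isomorphic (@E1112_1 F) E1112_2,
          forall gamma : F, ~ isomorphic E1112_1 (E1112_3 gamma)
        & forall beta gamma : F, beta != 0 ->
            ~ isomorphic E1112_1 (E1112_4 beta gamma)],
      [/\ forall gamma : F, ~ isomorphic E1112_2 (E1112_3 gamma),
          forall beta gamma : F, beta != 0 ->
            ~ isomorphic E1112_2 (E1112_4 beta gamma)
        & forall gamma beta' gamma' : F, beta' != 0 ->
            ~ isomorphic (E1112_3 gamma) (E1112_4 beta' gamma')],
      forall gamma gamma' : F, gamma != gamma' ->
        ~ isomorphic (E1112_3 gamma) (E1112_3 gamma')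
    & forall beta gamma beta' gamma' : F, beta != 0 -> beta' != 0 ->
        isomorphic (E1112_4 beta gamma) (E1112_4 beta' gamma') <->
        (beta', gamma') = (beta, gamma) \/
        (beta', gamma') = (beta^-1, - (beta ^- 3 * gamma))].
Proof.
have two0 : 2%:R != 0 :> F by apply: contra charF => two0; apply/andP; split.
split; last split.
- move=> E evE _ dimE _; split=> typE.
  + have [c1 [c2 [c3 [c4 [? ? ? ? isoE]]]]] := tri5_of_type14 evE dimE typE.
    by rewrite E14E; apply: isomorphic_trans isoE _; apply: tri5_14_iso.
  + split; last first.
      move=> [/isomorphic_sym iso1 iso2]; apply: (E131_not_iso sqr_i).
      exact: isomorphic_trans iso1 iso2.
    have [a2 [a3 [a4 [a5 [c2 [c3 [c4 [a0 ? ? ? isoE]]]]]]]] :=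
      tri5_of_type131 evE dimE typE.
    have [||||b2 [b3 [b4 [b5 [b0 isoT]]]]] :=
      @tri5_131_normalize F a2 a3 a4 a5 c2 c3 c4 => //.
    have {}isoE := isomorphic_trans isoE isoT.
    by case: (tri5_131_classify b5 two0 sqr_i b0) => /(isomorphic_trans isoE);
      [left|right].
  + have [a1 [b1 [a2 [b2 [a3 [b3 [c [? ? ? ? isoE]]]]]]]] :=
      tri5_of_type113 evE dimE typE.
    have [||||d1 [d2 [d3 isoT]]] :=
      @tri5_113_normalize F a1 b1 a2 b2 a3 b3 c => //.
    have {}isoE := isomorphic_trans isoE isoT.
    rewrite E113_1E E113_2E; case: (tri113_classify d1 d2 d3).
    * by move/(isomorphic_trans isoE); constructor 1.
    * by move/(isomorphic_trans isoE); constructor 2.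
    * move=> [a [? ? /(isomorphic_trans isoE)]]; constructor 3.
      by exists a; rewrite E113_3E.
  + have [a1 [b1 [c1 [a2 [b2 [c2 [a3 [b3 [c [? ? ? ? isoE]]]]]]]]]] :=
      tri5_of_type1112 evE dimE typE.
    have [||||p1 [q1 [p2 [q2 isoT]]]] :=
      @tri5_1112_normalize F a1 b1 c1 a2 b2 c2 a3 b3 c => //.
    have {}isoE := isomorphic_trans isoE isoT.
    rewrite E1112_1E E1112_2E; case: (tri1112_classify p1 q1 p2 q2).
    * by move/(isomorphic_trans isoE); constructor 1.
    * by move/(isomorphic_trans isoE); constructor 2.
    * move=> [g /(isomorphic_trans isoE)]; constructor 3.
      by exists g; rewrite E1112_3E.
    * move=> [b [g [? /(isomorphic_trans isoE)]]]; constructor 4.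
      by exists b, g; rewrite E1112_4E.
- rewrite E113_1E E113_2E; split.
  + exact: tri113_000_not_iso.
  + by move=> a _ _; rewrite E113_3E; apply: tri113_000_not_iso.
  + by move=> a a0 a1; rewrite E113_3E; apply: tri113_001_not_iso.
  + move=> a a' a0 a1 a'0 a'1; rewrite !E113_3E; split.
      exact: tri113_param_invariant.
    exact: tri113_param_iso.
rewrite E1112_1E E1112_2E; split; first split.
- by move=> /tri1112_0000_iso/eqP; rewrite oner_eq0.
- move=> g; rewrite E1112_3E => /tri1112_iso_fst0[/eqP].
  by rewrite oner_eq0.
- move=> b g _; rewrite E1112_4E => /tri1112_iso_fst0[/eqP].
  by rewrite oner_eq0.
- split.
  + move=> g; rewrite E1112_3E => /tri1112_iso_fst0[/eqP].
    by rewrite oner_eq0.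
  + move=> b g _; rewrite E1112_4E => /tri1112_iso_fst0[/eqP].
    by rewrite oner_eq0.
  + move=> g b' g' b'0; rewrite E1112_3E E1112_4E => /tri1112_1c00_iso[] /eqP.
      by rewrite oner_eq0.
    by rewrite (negbTE b'0).
- move=> g g' gg'; rewrite !E1112_3E => /tri1112_1c00_inj ggE.
  by rewrite ggE eqxx in gg'.
- by move=> b g b' g' b0 _; rewrite !E1112_4E; apply: tri1112_param_isoP.
Qed.
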